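(* Consider the generic filtering algorithm described in the context, where $\big(\{U_t^n\}_{n=1}^N\big)_{t\geq 1}$ is a sequence of independent sets of $N$ independent $\mathcal{U}(0,1)^2$ random variables, and let $\bar q\in(0,1/2)$. Then, for all $\kappa\in(0,1)$, there exist constants $C_\kappa\in(0,\infty)$ and $T_\kappa\in\{1,2,\dots\}$ such that, for all $q\in(0,\bar q]$ and all integers $T\geq T_\kappa$, we have $$\mathbb{P}\Big(\sup_{t\in\{1,\dots,T\}}\|\hat\eta_t^N-\hat\eta_t\|_{\mathrm{D}}\leq\kappa,\ \sup_{t\in\{1,\dots,T\}}\|\eta_t^N-\eta_t\|_{\mathrm{D}}\leq\kappa\Big)<1-q$$ for all integers $N\geq 1$ such that $N<C_\kappa\log(T/q)$.
   Context: $\mathcal{P}(\mathbb{R})$ is the set of Borel probability measures on $\mathbb{R}$. For $\pi\in\mathcal{P}(\mathbb{R})$, $F_\pi$ is its cumulative distribution function and $F_\pi^{-1}$ the generalized inverse of $F_\pi$. For $\pi_1,\pi_2\in\mathcal{P}(\mathbb{R})$, $\|\pi_1-\pi_2\|_{\mathrm{D}}=\sup_{-\infty<a<b<\infty}|\pi_1([a,b])-\pi_2([a,b])|$. For a measure $\pi$, function $f$ and kernel $K$ on $\mathbb{R}$: $\pi(f)=\int f\,d\pi$, $\pi K(A)=\int K(x,A)\pi(dx)$. Model. Fix $\rho\in\mathbb{R}$, $\sigma,c\in(0,\infty)$ and $\eta_1\in\mathcal{P}(\mathbb{R})$ (constants may depend on these). For $z\in\mathbb{R}$ let $M(z,dx)=\mathcal{N}(\rho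 z,\sigma^2)$, $G(z)=e^{-cz^2/2}$ and $Q(z,dx)=M(z,dx)G(x)$; $Q^1=Q$ and $Q^k(x,A)=\int Q(x,dx')Q^{k-1}(x',A)$ for $k\ge2$. Define $\hat\eta_1(dx)=G(x)\eta_1(dx)/\eta_1(G)$ and, for $t\geq 2$, $\eta_t=\hat\eta_{t-1}M$ and $\hat\eta_t(dx)=\hat\eta_1Q^{t-1}(dx)/\hat\eta_1Q^{t-1}(\mathbb{R})$. Generic filtering algorithm. Given $N\ge1$ and random point sets $\{U_t^n=(U_{t,1}^n,U_{t,2}^n)\}_{n=1}^N$ in $(0,1)^2$, $t\geq 1$, all defined on a probability space $(\Omega,\mathcal{F},\mathbb{P})$: set $X_1^n=F_{\eta_1}^{-1}(U_{1,1}^n)$. For $t\geq 2$ set $\hat X_{t-1}^n=F^{-1}_{\hat\eta_{t-1}^N}(U_{t,1}^n)$ and $X_t^n=F^{-1}_{M(\hat X_{t-1}^n,dx)}(U_{t,2}^n)$. For all $t\geq 1$, $W_t^n=G(X_t^n)/\sum_{m=1}^NG(X_t^m)$, $\eta_t^N=\frac1N\sum_{n=1}^N\delta_{\{X_t^n\}}$ and $\hat\eta_t^N=\sum_{n=1}^NW_t^n\delta_{\{X_t^n\}}$. (Operations with index $n$ are performed for all $n\in\{1,\dots,N\}$.) *)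

(* Defs.v *)
From HB Require Import structures.
From mathcomp Require Import all_boot all_order all_algebra finmap.
From mathcomp Require Import all_classical all_reals all_analysis.

Set Implicit Arguments.
Unset Strict Implicit.
Unset Printing Implicit Defensive.

Import Order.TTheory GRing.Theory Num.Theory.
Import numFieldNormedType.Exports.

Local Open Scope classical_set_scope.
Local Open Scope ring_scope.

(* Measures are handled below as set functions [set R -> \bar R]; the library's
   bundled measures coerce to this type and [\int[mu]] accepts it. *)
Section measures_on_the_line.
Context {R : realType}.
Implicit Types (mu nu : set (measurableTypeR R) -> \bar R).
Local Open Scope ereal_scope.

(* F_mu^-1 (u) = inf {x | u <= F_mu x}, with F_mu x = mu ]-oo, x].  Only
   meaningful for 0 < u < 1, where the set is nonempty and bounded below. *)
Definition quantile mu (u : R) : R :=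
  inf [set x : R | u%:E <= mu `]-oo, x]%classic].

Definition Dnorm mu nu : \bar R :=
  ereal_sup [set `|mu `[ab.1, ab.2]%classic - nu `[ab.1, ab.2]%classic|
            | ab in [set ab : R * R | (ab.1 < ab.2)%R]].

Definition kernel_action mu (K : R -> set (measurableTypeR R) -> \bar R)
  (A : set (measurableTypeR R)) : \bar R := \int[mu]_x K x A.

Definition normalized mu (A : set (measurableTypeR R)) : \bar R :=
  mu A * (fine (mu [set: R]))^-1%:E.

End measures_on_the_line.

Section model.
Context {R : realType} (rho sigma c : R).
Variable eta1 : probability (measurableTypeR R) R.
Local Open Scope ereal_scope.

(* The second argument of [normal_prob] is the standard deviation. *)
Definition mutation (z : R) : probability (measurableTypeR R) R :=
  normal_prob (rho * z)%R sigma.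

Definition potential (z : R) : R := expR (- (c * z ^+ 2 / 2))%R.

Definition Qkernel (z : R) (A : set (measurableTypeR R)) : \bar R :=
  \int[mutation z]_(x in A) (potential x)%:E.

(* Q^k for k >= 1: Q^1 = Q and Q^k (x, A) = \int Q (x, dy) Q^(k-1) (y, A);
   the value at k = 0 is not used. *)
Definition Qpow (k : nat) : R -> set (measurableTypeR R) -> \bar R :=
  iter k.-1 (fun K x => kernel_action (Qkernel x) K) Qkernel.

Definition updated1 (A : set (measurableTypeR R)) : \bar R :=
  (\int[eta1]_(x in A) (potential x)%:E) *
  (fine (\int[eta1]_x (potential x)%:E))^-1%:E.

(* The exact filter \hat\eta_t, t >= 1. *)
Definition updated (t : nat) : set (measurableTypeR R) -> \bar R :=
  if (t <= 1)%N then updated1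
  else normalized (kernel_action updated1 (Qpow t.-1)).

(* The exact predictor \eta_t, t >= 1. *)
Definition predicted (t : nat) : set (measurableTypeR R) -> \bar R :=
  if (t <= 1)%N then eta1 : set (measurableTypeR R) -> \bar R
  else kernel_action (updated t.-1) mutation.

Section particles.
Variable N : nat.

Definition weight (X : 'I_N -> R) (n : 'I_N) : R :=
  (potential (X n) / \sum_(m < N) potential (X m))%R.

Definition empirical (X : 'I_N -> R) (A : set (measurableTypeR R)) : \bar R :=
  (N%:R^-1)%:E * \sum_(n < N) \d_(X n) A.

Definition weighted_empirical (X : 'I_N -> R) (A : set (measurableTypeR R))
  : \bar R := \sum_(n < N) (weight X n)%:E * \d_(X n) A.

(* The particles (X_t^n)_n, t >= 1, produced from the points u_t^n = u t n;
   neither u 0 nor the value at t = 0 is used. *)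
Fixpoint particles (u : nat -> 'I_N -> R * R) (t : nat) : 'I_N -> R :=
  match t with
  | 0%N => fun=> 0%R
  | 1%N => fun n => quantile eta1 (u 1%N n).1
  | t'.+1 => fun n =>
      let Xhat := quantile (weighted_empirical (particles u t')) (u t n).1 in
      quantile (mutation Xhat) (u t n).2
  end.

End particles.
End model.

Section randomness.
Context d (Omega : measurableType d) (R : realType) (P : probability Omega R).
Local Open Scope ereal_scope.

(* Mutual independence of the family (X_i)_{i in D}: the product rule over
   every finite subfamily. *)
Definition mutually_independent d' (E : measurableType d') (I : choiceType)
    (D : set I) (X : I -> {RV P >-> E}) : Prop :=
  forall (J : {fset I}) (B : I -> set E),
    [set` J] `<=` D -> (forall i, measurable (B i)) ->
    P (\bigcap_(i in [set` J]) X i @^-1` B i) =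
    \prod_(i <- J) P (X i @^-1` B i).

Definition uniform_square :
    set (measurableTypeR R * measurableTypeR R)%type -> \bar R :=
  uniform_prob (@ltr01 R) \x uniform_prob (@ltr01 R).

(* The points U_t^n, t >= 1, 1 <= n <= N (n ranges over 'I_N), are i.i.d.
   uniform random variables in the open unit square. *)
Definition iid_uniform_points (N : nat)
    (U : nat -> 'I_N -> {RV P >-> (measurableTypeR R * measurableTypeR R)%type})
    : Prop :=
  [/\ forall t n w, (1 <= t)%N ->
        (0 < (U t n w).1 < 1)%R /\ (0 < (U t n w).2 < 1)%R,
      forall t n A, (1 <= t)%N -> measurable A ->
        distribution P (U t n) A = uniform_square A
    & mutually_independent [set tn : nat * 'I_N | (1 <= tn.1)%N]
        (fun tn => U tn.1 tn.2)].

End randomness.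

(* Main.v *)
(** Each filtering step collapses the particle cloud with probability at least
    [q0 ^ N], for a [q0] in ]0, 1[ that depends neither on the time nor on [N].
    Suppose that the algorithm has been [kappa]-accurate up to time [t].  Since
    the potential is Gaussian, the exact filters are tight uniformly in time, so
    the weighted empirical measure at time [t] gives a mass bounded from below to
    a fixed compact interval.  Cutting that interval into finitely many short
    pieces and ]0, 1] into finitely many cells, one of the pieces contains all
    the quantiles of a whole cell.  When the [N] resampling variables fall in
    this cell and the [N] mutation variables in a fixed interval, all the new
    particles lie in one short interval, whereas the predictor has a density
    bounded by the peak of the normal density: accuracy is lost at time [t + 1].
    The points at time [t + 1] being independent of the past, the probability of
    accuracy up to time [T] is at most [(1 - q0 ^ N) ^ (T - 1)], which is below
    [1 - q] when [N] is less than a small multiple of [ln (T / q)]. *)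

Require Import Defs.
From HB Require Import structures.
From mathcomp Require Import all_boot all_order all_algebra finmap.
From mathcomp Require Import all_classical all_reals all_analysis.
From mathcomp Require Import measurable_realfun ring lra.
Set Implicit Arguments.
Unset Strict Implicit.
Unset Printing Implicit Defensive.
Import Order.TTheory GRing.Theory Num.Theory.
Import numFieldNormedType.Exports.
Local Open Scope classical_set_scope.
Local Open Scope ring_scope.

(** * Measures with a density *)

Section density.
Context d (T : measurableType d) (R : realType).
Local Open Scope ereal_scope.
Variables (mu : {measure set T -> \bar R}) (f : T -> R).
Hypotheses (f0 : forall x, (0 <= f x)%R) (mf : measurable_fun [set: T] f).

(** The two proofs are arguments so that the measure structure declared below can be inferred from
    the term itself. *)
Definition density of (forall x, (0 <= f x)%R) & measurable_fun [set: T] f :=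
  fun A : set T => \int[mu]_(x in A) (f x)%:E.

Let density_set0 : density f0 mf set0 = 0.
Proof. exact: integral_set0. Qed.

Let density_ge0 A : 0 <= density f0 mf A.
Proof. by apply: integral_ge0 => x _; rewrite lee_fin. Qed.

Let density_sigma_additive : semi_sigma_additive (density f0 mf).
Proof.
move=> A mA tA mUA; rewrite /density ge0_integral_bigcup//; last 2 first.
- by apply/measurable_EFinP; exact: measurable_funTS.
- by move=> x _; rewrite lee_fin.
by apply: is_cvg_ereal_nneg_natsum_cond => n _ _; exact: density_ge0.
Qed.

HB.instance Definition _ := isMeasure.Build _ _ _ (density f0 mf)
  density_set0 density_ge0 density_sigma_additive.

Import HBNNSimple.

(** Monotone convergence along simple functions approximating [g] reduces the formula to indicators,
    where it is the definition of [density]. *)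
Lemma integral_density (g : T -> \bar R) : (forall x, 0 <= g x) ->
  measurable_fun [set: T] g ->
  \int[density f0 mf]_x g x = \int[mu]_x (g x * (f x)%:E).
Proof.
move=> g0 mg; pose h := nnsfun_approx measurableT mg.
have mfE : measurable_fun [set: T] (EFin \o f) by exact/measurable_EFinP.
have -> : \int[density f0 mf]_x g x =
    lim (\int[density f0 mf]_x (h n x)%:E @[n --> \oo]).
  have gE x : g x = lim ((h n x)%:E @[n --> \oo]).
    by apply/esym/cvg_lim => //; exact: cvg_nnsfun_approx.
  under eq_integral do rewrite gE.
  apply: monotone_convergence => //.
  - by move=> n; apply/measurable_EFinP.
  - by move=> n x _; rewrite lee_fin.
  - by move=> x _ a b ab; rewrite lee_fin; exact/lefP/nd_nnsfun_approx.
have -> : \int[mu]_x (g x * (f x)%:E) =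
    lim (\int[mu]_x ((h n x)%:E * (f x)%:E) @[n --> \oo]).
  have gE x : g x * (f x)%:E = lim ((h n x)%:E * (f x)%:E @[n --> \oo]).
    apply/esym/cvg_lim => //; apply: cvgeZr => //.
    exact: cvg_nnsfun_approx.
  under eq_integral do rewrite gE.
  apply: monotone_convergence => //.
  - by move=> n; apply/emeasurable_funM => //; exact/measurable_EFinP.
  - by move=> n x _; rewrite mule_ge0 ?lee_fin.
  - move=> x _ a b ab; rewrite lee_wpmul2r ?lee_fin//.
    exact/lefP/nd_nnsfun_approx.
suff suf n : \int[density f0 mf]_x (h n x)%:E =
    \int[mu]_x ((h n x)%:E * (f x)%:E).
  by under eq_fun do rewrite suf.
transitivity (\int[density f0 mf]_x
   (\sum_(y \in range (h n)) (y * \1_(h n @^-1` [set y]) x)%:E)).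
  by apply: eq_integral => t _; rewrite fimfunE -fsumEFin.
rewrite ge0_integral_fsum//; last 2 first.
- by move=> r; apply/measurable_EFinP; exact: measurable_funM.
- by move=> r x _; exact: nnfun_muleindic_ge0.
transitivity (\int[mu]_x (\sum_(y \in range (h n))
    (y * \1_(h n @^-1` [set y]) x)%:E * (f x)%:E)); last first.
  apply: eq_integral => x _.
  rewrite -ge0_mule_fsuml => [|y]; last exact: nnfun_muleindic_ge0.
  by rewrite fsumEFin// -(fimfunE _ x).
rewrite ge0_integral_fsum//; last 2 first.
- move=> y; apply: emeasurable_funM => //.
  by apply/measurable_EFinP; exact: measurable_funM.
- by move=> y x _; rewrite mule_ge0 ?lee_fin// -lee_fin nnfun_muleindic_ge0.
apply: eq_fsbigr => r rhn.
under eq_integral do rewrite EFinM.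
rewrite integralZl_indic_nnsfun//.
under [RHS]eq_integral do rewrite EFinM -muleA.
rewrite ge0_integralZl//.
- under [in RHS]eq_integral do rewrite muleC.
  rewrite [in RHS](eq_integral ((EFin \o f) \_ (h n @^-1` [set r]))); last first.
    by move=> x xE; rewrite epatch_indic.
  by rewrite -integral_mkcondr setTI integral_indic// setIT.
- by apply: emeasurable_funM => //; exact/measurable_EFinP.
- by move=> t _; rewrite mule_ge0 ?lee_fin.
- by move: rhn; rewrite inE => -[t _ <-]; rewrite lee_fin.
Qed.

End density.

(** * Gaussian integrals *)

Section gaussian.
Context {R : realType}.
Implicit Types m s b x : R.

(* Completing the square: the normal density times [exp (- b x^2 / 2)] is a
   multiple of the normal density of variance [s^2 / (1 + b s^2)]. *)
Lemma normal_pdf_tilt m s b x : s != 0 -> 0 <= b ->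
  normal_pdf m s x * expR (- (b * x ^+ 2 / 2)) =
  (Num.sqrt (1 + b * s ^+ 2))^-1 * expR (- (b / (1 + b * s ^+ 2) * m ^+ 2 / 2)) *
  normal_pdf (m / (1 + b * s ^+ 2)) (s / Num.sqrt (1 + b * s ^+ 2)) x.
Proof.
move=> s0 b0; set k := 1 + b * s ^+ 2.
have k0 : 0 < k by rewrite ltr_wpDr// mulr_ge0// sqr_ge0.
have sk0 : Num.sqrt k != 0 by rewrite gt_eqF// sqrtr_gt0.
rewrite !normal_pdfE ?mulf_neq0 ?invr_neq0// /normal_peak /normal_fun.
rewrite exprMn exprVn sqr_sqrtr ?ltW// -[LHS]mulrA -expRD.
rewrite [RHS]mulrACA -expRD; congr (_ * expR _).
  rewrite -invfM -sqrtrM ?ltW//; congr (Num.sqrt _)^-1.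
  by rewrite -mulrnAr; field; rewrite gt_eqF.
rewrite /k in k0 *.
by field; rewrite s0 /= gt_eqF.
Qed.

Lemma integral_normal_pdf_tilt m s b : s != 0 -> 0 <= b ->
  (\int[lebesgue_measure]_x
    (expR (- (b * x ^+ 2 / 2)) * normal_pdf m s x)%:E =
   ((Num.sqrt (1 + b * s ^+ 2))^-1 *
    expR (- (b / (1 + b * s ^+ 2) * m ^+ 2 / 2)))%:E)%E.
Proof.
move=> s0 b0.
under eq_integral do rewrite mulrC normal_pdf_tilt// EFinM.
rewrite ge0_integralZl//.
- by rewrite integral_normal_pdf mule1.
- by apply/measurable_EFinP; exact: measurable_normal_pdf.
- by move=> x _; rewrite lee_fin normal_pdf_ge0.
Qed.

Lemma integral_normal_prob_pdf m s (f : R -> \bar R) : (forall x, 0 <= f x)%E ->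
  measurable_fun [set: R] f ->
  (\int[normal_prob m s]_x f x =
   \int[lebesgue_measure]_x (f x * (normal_pdf m s x)%:E))%E.
Proof.
move=> f0 mf.
exact: (integral_density lebesgue_measure (normal_pdf_ge0 m s) (measurable_normal_pdf m s) f0 mf).
Qed.

End gaussian.

(** * Kernel actions and normalization as bundled measures *)

Section kernel_action_measure.
Context {R : realType}.
Local Open Scope ereal_scope.
Variables (m : {measure set (measurableTypeR R) -> \bar R})
  (K : R.-ker (measurableTypeR R) ~> (measurableTypeR R)).

Let action : set (measurableTypeR R) -> \bar R :=
  kernel_action m (fun x => K x : set _ -> \bar R).

Let action0 : action set0 = 0.
Proof. by apply: integral0_eq => x _; rewrite measure0. Qed.

Let action_ge0 A : 0 <= action A.
Proof. by apply: integral_ge0 => x _; exact: measure_ge0. Qed.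

Let action_sigma_additive : semi_sigma_additive action.
Proof.
move=> U mU tU mUU; rewrite [X in _ --> X](_ : _ =
  \int[m]_x (\sum_(n <oo) K x (U n))); last first.
  apply: eq_integral => x _.
  by apply/esym/cvg_lim => //; exact/measure_semi_sigma_additive.
apply/cvg_closeP; split.
  by apply: is_cvg_nneseries => n _ _; exact: integral_ge0.
rewrite closeE// integral_nneseries// => n.
exact: measurable_kernel.
Qed.

(** The model works with bare set functions; equality with a bundled measure opens measure theory to
    them. Countable additivity comes from exchanging the integral and the series. *)
Lemma kernel_action_measure :
  exists mu : {measure set (measurableTypeR R) -> \bar R},
    (mu : set _ -> \bar R) = kernel_action m (fun x => K x : set _ -> \bar R).
Proof.
pose M := isMeasure.Build _ _ _ action action0 action_ge0 action_sigma_additive.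
by exists (HB.pack_for {measure set (measurableTypeR R) -> \bar R} action M).
Qed.

End kernel_action_measure.

Lemma normalized_probability {R : realType}
    (m : {measure set (measurableTypeR R) -> \bar R}) :
  (0 < m setT < +oo)%E ->
  exists mu : probability (measurableTypeR R) R,
    (mu : set _ -> \bar R) = normalized m.
Proof.
(* The Dirac mass is the default of [mnormalize] for zero or infinite total mass, which the
   hypothesis excludes. *)
move=> /andP[m0 moo]; exists (mnormalize m (\d_ (0%R : measurableTypeR R))).
by apply/funext => A; rewrite /= /mnormalize (gt_eqF m0) (lt_eqF moo).
Qed.

(** * The mutation kernel, the kernel Q and its powers as bundled kernels *)

Section model.
Context {R : realType} (rho sigma c : R).
Hypotheses (sigma_gt0 : 0 < sigma) (c_gt0 : 0 < c).
Local Open Scope ereal_scope.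

Local Notation mutation := (mutation rho sigma).
Local Notation potential := (potential c).

Lemma potential_ge0 x : (0 <= potential x)%R.
Proof. exact: expR_ge0. Qed.

Lemma potential_le1 x : (potential x <= 1)%R.
Proof.
rewrite /Defs.potential -[leRHS]expR0 ler_expR oppr_le0.
by rewrite divr_ge0// mulr_ge0 ?sqr_ge0// ltW.
Qed.

Lemma measurable_gauss_exp (b : R) :
  measurable_fun [set: R] (fun x => expR (- (b * x ^+ 2 / 2)))%R.
Proof.
apply: measurableT_comp => //; apply: measurableT_comp => //.
by apply: measurable_funM => //; apply: measurable_funM.
Qed.

Lemma measurable_potential : measurable_fun [set: R] potential.
Proof. exact: measurable_gauss_exp. Qed.

Definition mutation_kernel :
  measurableTypeR R -> {measure set (measurableTypeR R) -> \bar R} := mutation.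

(** The normal density is jointly measurable in the starting point and the target, so Fubini-Tonelli
    applies. *)
Let measurable_mutation U : measurable U ->
  measurable_fun [set: measurableTypeR R] (mutation_kernel ^~ U).
Proof.
move=> mU; pose f (zx : R * R) :=
  ((normal_pdf (rho * zx.1) sigma zx.2 * \1_U zx.2)%R)%:E.
rewrite [X in measurable_fun _ X](_ : _ =
    fun z => \int[lebesgue_measure]_x f (z, x)); last first.
  apply/funext => z; rewrite /mutation_kernel /= /normal_prob integral_mkcond.
  by apply: eq_integral => x _; rewrite epatch_indic /f /= EFinM.
apply: (@measurable_fun_fubini_tonelli_F _ _ _ _ _ lebesgue_measure f).
  apply/measurable_EFinP; apply: measurable_funM; last first.
    by apply: measurableT_comp => //; exact: measurable_indic.
  rewrite [X in measurable_fun _ X](_ : _ = fun zx : R * R =>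
    (normal_peak sigma * expR (- (zx.2 - rho * zx.1) ^+ 2 / (sigma ^+ 2 *+ 2)))%R);
    last by apply/funext => zx; rewrite normal_pdfE ?gt_eqF.
  apply: measurable_funM => //; apply: measurableT_comp => //.
  apply: measurable_funM => //; apply: measurableT_comp => //.
  apply: measurable_funX; apply: measurable_funB => //.
  by apply: measurable_funM.
by move=> zx; rewrite lee_fin mulr_ge0 ?normal_pdf_ge0.
Qed.

HB.instance Definition _ :=
  isKernel.Build _ _ _ _ R mutation_kernel measurable_mutation.

Let mutation1 z : mutation_kernel z setT = 1.
Proof. exact: probability_setT. Qed.

HB.instance Definition _ :=
  Kernel_isProbability.Build _ _ _ _ R mutation_kernel mutation1.

Definition mutation_pker : R.-pker (measurableTypeR R) ~> (measurableTypeR R) :=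
  mutation_kernel.

(** This is [Qkernel], written as a density so as to carry a measure structure. *)
Definition tilted_kernel (z : measurableTypeR R) :
    {measure set (measurableTypeR R) -> \bar R} :=
  density (mutation z) potential_ge0 measurable_potential.

Let measurable_tilted U : measurable U ->
  measurable_fun [set: measurableTypeR R] (tilted_kernel ^~ U).
Proof.
move=> mU; rewrite [X in measurable_fun _ X](_ : _ =
  fun z => \int[mutation_kernel z]_x (potential x * \1_U x)%:E); last first.
  apply/funext => z; rewrite /tilted_kernel /= /density integral_mkcond.
  by apply: eq_integral => x _; rewrite epatch_indic /= EFinM.
apply: measurable_fun_integral_kernel.
- by move=> V mV; exact: measurable_mutation.
- by move=> x; rewrite lee_fin mulr_ge0 ?potential_ge0.
- apply/measurable_EFinP/measurable_funM; first exact: measurable_potential.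
  exact: measurable_indic.
Qed.

HB.instance Definition _ :=
  isKernel.Build _ _ _ _ R tilted_kernel measurable_tilted.

Let tilted_le1 : ereal_sup [set tilted_kernel z setT | z in [set: measurableTypeR R]] <= 1.
Proof.
apply: ge_ereal_sup => _ [z _ <-]; rewrite -(mutation1 z) -[leRHS]mul1e -integral_cst//.
apply: ge0_le_integral => //.
- by move=> x _; rewrite lee_fin potential_ge0.
- by apply/measurable_EFinP; exact: measurable_potential.
- by move=> x _; rewrite lee_fin potential_le1.
Qed.

HB.instance Definition _ :=
  Kernel_isSubProbability.Build _ _ _ _ R tilted_kernel tilted_le1.

(** [Qpow] rebuilt from kernel composition: each power is then a sub-probability kernel, which
    supplies additivity and measurability. *)
Definition tilted_pow (k : nat) : R.-spker (measurableTypeR R) ~> (measurableTypeR R) :=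
  iter k.-1 (fun K => mkcomp_noparam tilted_kernel K :
    R.-spker (measurableTypeR R) ~> (measurableTypeR R)) tilted_kernel.

Lemma tilted_powE k z : (tilted_pow k z : set _ -> \bar R) = Qpow rho sigma c k z.
Proof.
rewrite /tilted_pow /Qpow; elim: k.-1 z => //= n IH z.
by apply/funext => A; apply: eq_integral => y _; rewrite IH.
Qed.

End model.

(** * Uniform tightness of the exact filters *)

Section filter.
Context {R : realType} (rho sigma c : R).
Hypotheses (sigma_gt0 : 0 < sigma) (c_gt0 : 0 < c).

Local Notation mutation := (mutation rho sigma).
Local Notation potential := (potential c).

(* The total mass of [Q^k z] is [gain k z] (for [k >= 1], see [Qpow_setT]); the
   recursions come from completing the square in the first step of the chain. *)
Fixpoint decay (k : nat) : R :=
  if k is k'.+1 then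
    rho ^+ 2 * (decay k' + c) / (1 + (decay k' + c) * sigma ^+ 2)
  else 0.

Fixpoint amplitude (k : nat) : R :=
  if k is k'.+1 then
    amplitude k' / Num.sqrt (1 + (decay k' + c) * sigma ^+ 2)
  else 1.

Definition gain (k : nat) (z : R) : R :=
  amplitude k * expR (- (decay k * z ^+ 2 / 2)).

Lemma decay_ge0 k : 0 <= decay k.
Proof.
elim: k => //= k IH.
have h : 0 <= decay k + c by rewrite addr_ge0// ltW.
apply: divr_ge0; first by rewrite mulr_ge0 ?sqr_ge0.
by rewrite addr_ge0// mulr_ge0 ?sqr_ge0.
Qed.

(** Since [u / (1 + u * sigma ^+ 2)] never exceeds [1 / sigma ^+ 2], the bound does not depend on
    [k]; the uniformity in time of the tail bounds rests on it. *)
Lemma decay_le k : decay k <= rho ^+ 2 / sigma ^+ 2.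
Proof.
have s2 : 0 < sigma ^+ 2 by rewrite exprn_gt0.
case: k => [|k] /=; first by rewrite divr_ge0 ?sqr_ge0.
have h : 0 <= decay k + c by rewrite addr_ge0 ?decay_ge0// ltW.
have h1 : 0 <= (decay k + c) * sigma ^+ 2 by rewrite mulr_ge0// ltW.
rewrite ler_pdivrMr; last by lra.
rewrite -[leRHS]mulrA ler_wpM2l ?sqr_ge0// mulrC ler_pdivlMr//.
by lra.
Qed.

Lemma amplitude_gt0 k : 0 < amplitude k.
Proof.
elim: k => //= k IH; rewrite divr_gt0// sqrtr_gt0 ltr_wpDr//.
by rewrite mulr_ge0 ?sqr_ge0// addr_ge0 ?decay_ge0// ltW.
Qed.

(** One step divides the amplitude by a factor bounded uniformly in [k], because [decay k] is
    bounded. This lets amplitudes of consecutive times cancel in [updated_tail]. *)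
Lemma amplitude_ratio k :
  amplitude k / Num.sqrt (1 + (rho ^+ 2 / sigma ^+ 2 + c) * sigma ^+ 2) <=
  amplitude k.+1.
Proof.
have pos a : 0 <= a -> 0 < 1 + (a + c) * sigma ^+ 2.
  move=> a0; rewrite ltr_wpDr// mulr_ge0 ?sqr_ge0// addr_ge0// ltW//.
rewrite /= ler_wpM2l ?(ltW (amplitude_gt0 k))//.
rewrite lef_pV2 ?posrE ?sqrtr_gt0 ?pos ?decay_ge0 ?divr_ge0 ?sqr_ge0//.
by rewrite ler_wsqrtr// lerD2l ler_wpM2r ?sqr_ge0// lerD2r decay_le.
Qed.

Lemma gain_ge0 k z : 0 <= gain k z.
Proof. by rewrite mulr_ge0 ?expR_ge0// ltW// amplitude_gt0. Qed.

Lemma measurable_gain k : measurable_fun [set: R] (gain k).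
Proof.
by apply: measurable_funM => //; exact: measurable_gauss_exp.
Qed.

Lemma gain_le k z : gain k z <= amplitude k.
Proof.
rewrite ler_piMr ?(ltW (amplitude_gt0 k))// -[leRHS]expR0 ler_expR oppr_le0.
by rewrite divr_ge0// mulr_ge0 ?sqr_ge0 ?decay_ge0.
Qed.

Lemma gain_ge k z :
  amplitude k * expR (- (rho ^+ 2 / sigma ^+ 2 * z ^+ 2 / 2)) <= gain k z.
Proof.
rewrite ler_wpM2l ?(ltW (amplitude_gt0 k))// ler_expR lerN2.
by rewrite ler_wpM2r// ler_wpM2r ?sqr_ge0// decay_le.
Qed.

Lemma integral_tilted z (g : R -> \bar R) : (forall x, 0 <= g x)%E ->
  measurable_fun [set: R] g ->
  (\int[tilted_kernel rho sigma c z]_x g x =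
   \int[mutation z]_x (g x * (potential x)%:E))%E.
Proof.
move=> g0 mg.
exact: (integral_density (mutation z) (potential_ge0 c) (measurable_potential c) g0 mg).
Qed.

(** The potential adds [c] to the decay rate; integrating against the normal density then gives the
    recursions of [decay] and [amplitude]. *)
Lemma integral_tilted_gain k z :
  (\int[tilted_kernel rho sigma c z]_x (gain k x)%:E = (gain k.+1 z)%:E)%E.
Proof.
have mg := measurable_gain k.
rewrite integral_tilted; last 2 first.
- by move=> x; rewrite lee_fin gain_ge0.
- exact/measurable_EFinP.
have mp : measurable_fun [set: R] potential by exact: measurable_potential.
rewrite integral_normal_prob_pdf; last 2 first.
- by move=> x; rewrite -EFinM lee_fin mulr_ge0 ?gain_ge0 ?potential_ge0.
- by apply: emeasurable_funM; exact/measurable_EFinP.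
have ac0 : 0 <= decay k + c by rewrite addr_ge0 ?decay_ge0// ltW.
transitivity (\int[lebesgue_measure]_x ((amplitude k)%:E *
  (expR (- ((decay k + c) * x ^+ 2 / 2)) * normal_pdf (rho * z) sigma x)%:E))%E.
  apply: eq_integral => x _; rewrite -!EFinM; congr EFin.
  rewrite /gain /Defs.potential [RHS]mulrA -[in LHS](mulrA (amplitude k)) -expRD.
  by congr (_ * expR _ * _); ring.
have mE := measurable_normal_pdf (rho * z) sigma.
rewrite ge0_integralZl//; last 3 first.
- apply/measurable_EFinP/measurable_funM => //.
  exact: measurable_gauss_exp.
- by move=> x _; rewrite lee_fin mulr_ge0 ?expR_ge0 ?normal_pdf_ge0.
- by rewrite lee_fin ltW ?amplitude_gt0.
rewrite integral_normal_pdf_tilt ?gt_eqF// -EFinM /gain /= mulrA.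
congr (_ * expR _)%:E; field.
by rewrite gt_eqF// ltr_wpDr// mulr_ge0 ?sqr_ge0.
Qed.

Lemma QpowSS k z A : Qpow rho sigma c k.+2 z A =
  (\int[tilted_kernel rho sigma c z]_y Qpow rho sigma c k.+1 y A)%E.
Proof. by []. Qed.

Lemma Qpow_setT k z :
  Qpow rho sigma c k.+1 z setT = (gain k.+1 z)%:E.
Proof.
elim: k z => [|k IH] z.
  rewrite -integral_tilted_gain [RHS](_ : _ =
    (\int[tilted_kernel rho sigma c z]_x (cst 1 x))%E); last first.
    apply: eq_integral => x _.
    by rewrite /gain /= mul0r mul0r oppr0 expR0 mulr1.
  by rewrite (integral_cst (tilted_kernel rho sigma c z))// mul1e.
rewrite QpowSS -integral_tilted_gain.
by apply: eq_integral => y _; rewrite IH.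
Qed.

Lemma potential_out (B x : R) : 0 <= B -> (~` `[(- B)%R, B]%classic) x ->
  potential x <= expR (- (c * B ^+ 2 / 2)).
Proof.
move=> B0 /=; rewrite in_itv /= => /negP; rewrite -ler_norml -ltNge => Bx.
rewrite ler_expR lerN2 ler_wpM2r// ler_wpM2l ?(ltW c_gt0)//.
by rewrite -[leRHS](real_normK (num_real x)) lerXn2r ?nnegrE// ltW.
Qed.

(** Only the last step sees the tail set: there the potential is at most
    [expR (- (c * B ^+ 2 / 2))], and the first [k] steps contribute their total mass [gain k z]. *)
Lemma Qpow_tail k z (B : R) : 0 <= B ->
  (Qpow rho sigma c k.+1 z (~` `[(- B)%R, B]%classic) <=
    ((expR (- (c * B ^+ 2 / 2)) * gain k z)%R)%:E)%E.
Proof.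
move=> B0; elim: k z => [|k IH] z.
  rewrite /gain /= mul0r mul0r oppr0 expR0 !mulr1.
  rewrite /Qpow /=.
  apply: (@le_trans _ _ (\int[mutation z]_(x in ~` `[(- B)%R, B]%classic)
      (expR (- (c * B ^+ 2 / 2)))%:E)%E).
    apply: ge0_le_integral => //.
    - exact: measurableC.
    - by move=> x _; rewrite lee_fin potential_ge0.
    - apply: measurable_funTS; apply/measurable_EFinP.
      exact: measurable_potential.
    - by move=> x Bx; rewrite lee_fin; exact: potential_out.
  rewrite integral_cst//; last exact: measurableC.
  rewrite -[leRHS]mule1 lee_wpmul2l ?lee_fin ?expR_ge0//.
  by apply: probability_le1; exact: measurableC.
have mg := measurable_gain k; rewrite QpowSS.
apply: (@le_trans _ _ (\int[tilted_kernel rho sigma c z]_y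
    ((expR (- (c * B ^+ 2 / 2)) * gain k y)%R)%:E)%E).
  apply: ge0_le_integral => //.
  - by move=> y _; rewrite -(tilted_powE rho sigma_gt0 c_gt0); exact: measure_ge0.
  - rewrite [X in measurable_fun _ X](_ : _ =
      fun y => tilted_pow rho sigma_gt0 c_gt0 k.+1 y (~` `[(- B)%R, B]%classic)); last first.
      by apply/funext => y; rewrite tilted_powE.
    by apply: measurable_kernel; exact: measurableC.
  - by apply/measurable_EFinP; exact: measurable_funM.
under eq_integral do rewrite EFinM.
rewrite ge0_integralZl//; last 2 first.
- by apply/measurable_EFinP.
- by move=> x _; rewrite lee_fin gain_ge0.
by rewrite [X in (_ * X)%E]integral_tilted_gain EFinM.
Qed.

Variable eta1 : probability (measurableTypeR R) R.

Local Notation updated := (updated rho sigma c eta1).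
Local Notation predicted := (predicted rho sigma c eta1).
Local Notation updated1 := (updated1 c eta1).

Definition tilted1 : {measure set (measurableTypeR R) -> \bar R} :=
  density eta1 (potential_ge0 c) (measurable_potential c).

(** If the integral were 0, the integrand would vanish almost everywhere, although it is positive at
    every point. *)
Lemma integral_gauss_bounds (mu : probability (measurableTypeR R) R) (b : R) :
  0 <= b ->
  (0 < \int[mu]_x (expR (- (b * x ^+ 2 / 2)))%:E <= 1)%E.
Proof.
move=> b0; have me := measurable_gauss_exp b; apply/andP; split.
  rewrite lt_neqAle integral_ge0 ?andbT; last first.
    by move=> x _; rewrite lee_fin expR_ge0.
  rewrite eq_sym; apply/negP => /eqP I0.
  have : {ae mu, forall x, [set: measurableTypeR R] x ->
      (expR (- (b * x ^+ 2 / 2)))%:E = cst 0%E x}.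
    apply: (ae_eq_integral_abs mu measurableT _).1.
      by apply/measurable_EFinP.
    rewrite -I0; apply: eq_integral => x _.
    by rewrite gee0_abs// lee_fin expR_ge0.
  move=> [A [mA A0 sA]].
  have : (mu setT <= mu A)%E.
    apply: le_measure; rewrite ?inE//; apply: subset_trans sA => x _ /= /(_ Logic.I) [].
    by apply/eqP; rewrite gt_eqF// expR_gt0.
  by rewrite A0 probability_setT leNgt lte01.
rewrite -[leRHS](probability_setT mu) -[leRHS]mul1e -integral_cst//.
apply: ge0_le_integral => //.
- by apply/measurable_EFinP.
- move=> x _; rewrite lee_fin -[leRHS]expR0 ler_expR oppr_le0.
  by rewrite divr_ge0// mulr_ge0 ?sqr_ge0.
Qed.

Lemma tilted1_setT : (0 < tilted1 setT <= 1)%E.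
Proof. exact: (integral_gauss_bounds eta1 (ltW c_gt0)). Qed.

Lemma updated1_prob : exists m : probability (measurableTypeR R) R,
  (m : set _ -> \bar R) = updated1.
Proof.
have /andP[h0 h1] := tilted1_setT.
have [m mE] : exists m : probability (measurableTypeR R) R,
    (m : set _ -> \bar R) = normalized tilted1.
  by apply: normalized_probability; rewrite h0 (le_lt_trans h1) ?ltry.
by exists m; rewrite mE.
Qed.

(** The decay rate lies between 0 and [rho ^+ 2 / sigma ^+ 2], so the normalizing constant is
    comparable to [amplitude k] with constants independent of [k]. *)
Lemma total_gain (m : probability (measurableTypeR R) R) k :
  (m : set _ -> \bar R) = updated1 ->
  ((amplitude k)%:E *
     \int[m]_z (expR (- (rho ^+ 2 / sigma ^+ 2 * z ^+ 2 / 2)))%:E <=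
   \int[m]_z (gain k z)%:E <= (amplitude k)%:E)%E.
Proof.
move=> mE; have mg := measurable_gain k.
have me := measurable_gauss_exp (rho ^+ 2 / sigma ^+ 2).
have A0 := amplitude_gt0 k; apply/andP; split.
  rewrite -ge0_integralZl//; [|by apply/measurable_EFinP|by rewrite lee_fin ltW].
  apply: ge0_le_integral => //.
  - by move=> x _; rewrite -EFinM lee_fin mulr_ge0 ?expR_ge0 ?ltW.
  - by apply/measurable_EFinP; apply: measurable_funM.
  - by apply/measurable_EFinP.
  - by move=> x _; rewrite -EFinM lee_fin gain_ge.
rewrite -[leRHS]mule1 -(probability_setT m) -integral_cst//.
apply: ge0_le_integral => //.
- by move=> x _; rewrite lee_fin gain_ge0.
- by apply/measurable_EFinP.
- by move=> x _; rewrite lee_fin gain_le.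
Qed.

Lemma propagated_measure k : exists mu : {measure set (measurableTypeR R) -> \bar R},
  (mu : set _ -> \bar R) = kernel_action updated1 (Qpow rho sigma c k).
Proof.
have [m mE] := updated1_prob.
have [mu muE] := kernel_action_measure m (tilted_pow rho sigma_gt0 c_gt0 k).
exists mu; rewrite muE -mE; congr kernel_action.
by apply/funext => z; rewrite tilted_powE.
Qed.

Lemma propagated_setT (m : probability (measurableTypeR R) R) k :
  (m : set _ -> \bar R) = updated1 ->
  kernel_action updated1 (Qpow rho sigma c k.+1) setT =
  (\int[m]_z (gain k.+1 z)%:E)%E.
Proof.
move=> <-; rewrite /kernel_action; apply: eq_integral => z _.
by rewrite Qpow_setT.
Qed.

Lemma propagated_setT_gt0 k :
  (0 < kernel_action updated1 (Qpow rho sigma c k.+1) setT < +oo)%E.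
Proof.
have [m mE] := updated1_prob; rewrite (propagated_setT k mE).
have /andP[h1 h2] := total_gain k.+1 mE.
rewrite (le_lt_trans h2) ?ltry// andbT (lt_le_trans _ h1)//.
rewrite mule_gt0 ?lte_fin ?amplitude_gt0//.
by have /andP[] := integral_gauss_bounds m (divr_ge0 (sqr_ge0 rho) (sqr_ge0 sigma)).
Qed.

Lemma updated_prob t : exists m : probability (measurableTypeR R) R,
  (m : set _ -> \bar R) = updated t.
Proof.
rewrite /Defs.updated; case: ifP => [_|]; first exact: updated1_prob.
case: t => [|[|k]]//= _.
have [mu muE] := propagated_measure k.+1.
have [m mE] := @normalized_probability _ mu (eq_ind_r (fun f => 0 < f setT < +oo)%E
  (propagated_setT_gt0 k) muE).
by exists m; rewrite mE muE.
Qed.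

Lemma predicted_prob t : exists m : probability (measurableTypeR R) R,
  (m : set _ -> \bar R) = predicted t.
Proof.
rewrite /Defs.predicted; case: ifP => _; first by exists eta1.
have [m mE] := updated_prob t.-1.
have [mu muE] := kernel_action_measure m (mutation_pker rho sigma_gt0).
have mu1 : mu setT = 1%E.
  rewrite muE /kernel_action -(probability_setT m) -[RHS]mul1e -integral_cst//.
  by apply: eq_integral => z _; exact: probability_setT.
have [p pE] : exists p : probability (measurableTypeR R) R,
    (p : set _ -> \bar R) = normalized mu.
  by apply: normalized_probability; rewrite mu1 ltry lte01.
exists p; rewrite pE -mE -[RHS]muE; apply/funext => A.
by rewrite /normalized mu1 /= invr1 mule1.
Qed.

(** From time 2 on, the predictor is a mixture of normal laws, whose densities are bounded by
    [normal_peak sigma]; at time 1 it is [eta1], which may have atoms. *)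
Lemma predicted_itv_le t (a l : R) : (2 <= t)%N -> 0 <= l ->
  (predicted t `[a, (a + l)%R]%classic <= (normal_peak sigma * l)%:E)%E.
Proof.
move=> t2 l0; rewrite /Defs.predicted leqNgt t2 /=.
have [m <-] := updated_prob t.-1; rewrite /kernel_action.
rewrite -[leRHS]mule1 -(probability_setT m) -integral_cst//.
apply: ge0_le_integral => //.
- exact: (measurable_kernel (mutation_pker rho sigma_gt0)).
- move=> z _; rewrite /= /normal_prob.
  apply: (@le_trans _ _ (\int[lebesgue_measure]_(x in `[a, (a + l)%R]%classic)
    (normal_peak sigma)%:E)%E).
    apply: ge0_le_integral => //.
    + by move=> x _; rewrite lee_fin normal_pdf_ge0.
    + apply: measurable_funTS; apply/measurable_EFinP.
      exact: measurable_normal_pdf.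
    + by move=> x _; rewrite lee_fin normal_pdf_ub ?gt_eqF.
  rewrite integral_cst//= lebesgue_measure_itv /= lte_fin EFinM.
  rewrite lee_wpmul2l ?lee_fin ?normal_peak_ge0//.
  by case: ifP => _; rewrite -?EFinB lee_fin//; lra.
Qed.

(** After time 1 the filter is a ratio: the numerator is controlled by [Qpow_tail] and the amplitude
    at one time, the denominator by the amplitude at the next, and these two amplitudes have a
    bounded quotient. *)
Lemma updated_tail : exists D : R, 0 < D /\ forall t (B : R), (1 <= t)%N -> 0 <= B ->
  (updated t (~` `[(- B)%R, B]%classic) <= (D * expR (- (c * B ^+ 2 / 2)))%:E)%E.
Proof.
have [m mE] := updated1_prob.
pose b := rho ^+ 2 / sigma ^+ 2.
have b0 : 0 <= b by rewrite divr_ge0 ?sqr_ge0.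
pose S := Num.sqrt (1 + (b + c) * sigma ^+ 2).
have S0 : 0 < S.
  rewrite sqrtr_gt0 ltr_wpDr// mulr_ge0 ?sqr_ge0// addr_ge0//.
  exact: ltW.
have := integral_gauss_bounds m b0.
case kE : (\int[m]_x (expR (- (b * x ^+ 2 / 2)))%:E)%E => [k| |]; last 2 first.
- by rewrite ltey.
- by rewrite ltNge leNye.
rewrite lte_fin => /andP[k0 _].
have := tilted1_setT; case gE : (tilted1 setT) => [g| |]; last 2 first.
- by rewrite ltey.
- by rewrite ltNge leNye.
rewrite lte_fin => /andP[g0 _].
(* The term [g^-1] serves time 1, where the filter has its own normalization, and [S / k] serves all
   later times. *)
exists (g^-1 + S / k); split; first by rewrite addr_gt0 ?invr_gt0// divr_gt0.
move=> t B t0 B0; set E := expR _; set A : set (measurableTypeR R) := (~` _).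
have mA : measurable A by exact: measurableC.
have E0 : 0 < E by exact: expR_gt0.
case: t t0 => [//|[_|j _]].
  apply: (@le_trans _ _ (g^-1 * E)%:E); last first.
    by rewrite lee_fin ler_wpM2r ?(ltW E0)// lerDl ltW// divr_gt0.
  rewrite [X in (X <= _)%E](_ : _ = tilted1 A * g^-1%:E)%E; last first.
    by rewrite -[g]/(fine g%:E) -gE.
  rewrite muleC EFinM.
  rewrite lee_wpmul2l ?lee_fin ?invr_ge0 ?(ltW g0)//.
  apply: (@le_trans _ _ (\int[eta1]_(x in A) E%:E)%E).
    apply: ge0_le_integral => //.
    - by move=> x _; rewrite lee_fin potential_ge0.
    - apply: measurable_funTS; apply/measurable_EFinP.
      exact: measurable_potential.
    - by move=> x Ax; rewrite lee_fin; exact: potential_out.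
  rewrite integral_cst// -[leRHS]mule1 lee_wpmul2l ?lee_fin ?(ltW E0)//.
  exact: probability_le1.
apply: (@le_trans _ _ (S / k * E)%:E); last first.
  by rewrite lee_fin ler_wpM2r ?(ltW E0)// lerDr ltW// invr_gt0.
rewrite /Defs.updated /= /normalized (propagated_setT j mE).
have /andP[h1 h2] := total_gain j.+1 mE.
rewrite -/b kE -EFinM in h1.
case tE : (\int[m]_z (gain j.+1 z)%:E)%E h1 h2 => [r| |]; last 2 first.
- by rewrite leye_eq.
- by rewrite leeNy_eq.
rewrite !lee_fin => h1 h2.
have Ar : amplitude j / S * k <= r.
  by rewrite (le_trans _ h1)// ler_wpM2r ?(ltW k0)// amplitude_ratio.
have aj0 := amplitude_gt0 j.
have r0 : 0 < r by rewrite (lt_le_trans _ Ar)// mulr_gt0// divr_gt0.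
apply: (@le_trans _ _ ((E * amplitude j)%:E * (r^-1)%:E)%E).
  rewrite /= lee_wpmul2r ?lee_fin ?invr_ge0 ?(ltW r0)//.
  rewrite -mE /kernel_action.
  have mg := measurable_gain j.
  apply: (@le_trans _ _ (\int[m]_z (E * gain j z)%:E)%E).
    apply: ge0_le_integral => //.
    - by move=> z _; rewrite -(tilted_powE rho sigma_gt0 c_gt0); exact: measure_ge0.
    - rewrite [X in measurable_fun _ X](_ : _ =
        fun y => tilted_pow rho sigma_gt0 c_gt0 j.+1 y A); last first.
        by apply/funext => y; rewrite tilted_powE.
      exact: measurable_kernel.
    - by apply/measurable_EFinP; exact: measurable_funM.
    - by move=> z _; exact: Qpow_tail.
  under eq_integral do rewrite EFinM.
  rewrite ge0_integralZl//; last 3 first.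
  - by apply/measurable_EFinP.
  - by move=> x _; rewrite lee_fin gain_ge0.
  - by rewrite lee_fin ltW.
  rewrite EFinM lee_wpmul2l ?lee_fin ?(ltW E0)//.
  by have /andP[] := total_gain j mE.
rewrite -EFinM lee_fin -[leLHS]mulrA [leLHS]mulrC ler_wpM2r ?(ltW E0)//.
rewrite ler_pdivrMr// mulrAC ler_pdivlMr//.
by move: Ar; rewrite mulrAC ler_pdivrMr// [X in _ <= X -> _]mulrC.
Qed.

Lemma updated_tight (e : R) : 0 < e -> exists2 B : R, 0 < B &
  forall t, (1 <= t)%N -> ((1 - e)%:E <= updated t `[(- B)%R, B]%classic)%E.
Proof.
move=> e0; have [D [D0 HD]] := updated_tail.
(* With this choice [B >= 1] and [c * B ^+ 2 / 2 >= D / e], so that [1 + x <= expR x] brings the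
   tail bound below [e]. *)
pose B := 1 + 2 * (D / e) / c.
have B1 : 1 <= B by rewrite lerDl ltW// divr_gt0// mulr_gt0// divr_gt0.
have B0 : 0 < B by lra.
exists B => // t t1.
have [m mE] := updated_prob t.
have := HD t B t1 (ltW B0); rewrite -mE.
rewrite probability_setC//.
rewrite -[m `[_, _]%classic]fineK ?fin_num_measure// -EFinB !lee_fin => h.
rewrite lerBlDr -lerBlDl (le_trans h)//.
rewrite expRN ler_pdivrMr ?expR_gt0// [leRHS]mulrC -ler_pdivrMr//.
apply: (le_trans _ (expR_ge1Dx _)).
have : D / e <= c * B / 2.
  have -> : c * B / 2 = c / 2 + D / e by rewrite /B; field; rewrite !gt_eqF.
  by rewrite lerDr divr_ge0// ltW.
move=> h1; have h2 : c * B / 2 <= c * B ^+ 2 / 2.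
  by rewrite ler_wpM2r// ler_wpM2l ?(ltW c_gt0)// expr2 ler_peMl ?(ltW B0).
by rewrite (le_trans h1)// (le_trans h2)// lerDr.
Qed.

End filter.

(** * Quantiles and discrepancy *)

Section quantile.
Context {R : realType}.
Implicit Types (mu nu : probability (measurableTypeR R) R).

(** As a random variable under [mu], the identity has the distribution function of [mu] as its
    [cdf]. *)
Let idR : measurableTypeR R -> R := idfun.

HB.instance Definition _ :=
  @isMeasurableFun.Build _ _ _ _ idR (@measurable_id _ _ setT).

(** The limits of the distribution function at both infinities make the set under the infimum
    nonempty and bounded below, and right continuity makes the infimum attained. Every later use of
    quantiles goes through this equivalence. *)
Lemma quantile_le mu (u x : R) : 0 < u < 1 ->
  (quantile mu u <= x) = (u%:E <= mu `]-oo, x]%classic)%E.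
Proof.
move=> /andP[u0 u1]; pose F := cdf (idR : {RV mu >-> R}).
have FE y : mu `]-oo, y]%classic = F y by [].
have F_nd : {homo F : y z / y <= z >-> (y <= z)%E} by exact: cdf_nondecreasing.
have F_rc : right_continuous F by exact: cdf_right_continuous.
pose S := [set y : R | (u%:E <= mu `]-oo, y]%classic)%E].
have S_lb : has_lbound S.
  have : \forall y \near -oo, (F y < u%:E)%E.
    have := cvg_cdfNy0 (idR : {RV mu >-> R}).
    by move=> /(_ [set z | (z < u%:E)%E]); apply; exact: open_ereal_lt'.
  move=> [y0 [_ Hy0]]; exists (y0 - 1) => y Sy; rewrite leNgt; apply/negP => yy.
  have : (F y < u%:E)%E by apply: Hy0; lra.
  by rewrite ltNge -FE Sy.
have S_ne : S !=set0.
  have : \forall y \near +oo, (u%:E < F y)%E.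
    have := cvg_cdfy1 (idR : {RV mu >-> R}).
    by move=> /(_ [set z | (u%:E < z)%E]); apply; exact: open_ereal_gt'.
  move=> [y0 [_ Hy0]]; exists (y0 + 1); rewrite /S /= ltW// FE.
  by apply: Hy0; lra.
apply/idP/idP => [qx|ux]; last by apply: ge_inf.
rewrite leNgt; apply/negP => Fxu.
(* By right continuity some [y] beyond [x] is still below level [u], which forces the infimum up to
   [y]. *)
have : \forall y \near x^'+, (F y < u%:E)%E.
  have := F_rc x.
  by move=> /(_ [set z | (z < u%:E)%E]); apply; exact: open_ereal_lt'.
move=> nF.
have [y xy Fyu] : exists2 y, x < y & (F y < u%:E)%E.
  have : exists y, (F y < u%:E)%E /\ x < y.
    by apply: (@filter_ex _ x^'+); exact: filterI nF (nbhs_right_gt x).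
  by move=> [y [Fyu xy]]; exists y.
have : y <= quantile mu u.
  apply: lb_le_inf => // z Sz; rewrite leNgt; apply/negP => zy.
  have := le_lt_trans (F_nd _ _ (ltW zy)) Fyu.
  by rewrite ltNge -FE Sz.
by rewrite leNgt (le_lt_trans qx xy).
Qed.

Lemma measurable_quantile d (W : measurableType d)
    (mu : W -> probability (measurableTypeR R) R) (u : W -> R) :
  (forall w, 0 < u w < 1) -> measurable_fun [set: W] u ->
  (forall x, measurable_fun [set: W] (fun w => mu w `]-oo, x]%classic)) ->
  measurable_fun [set: W] (fun w => quantile (mu w) (u w)).
Proof.
move=> u01 mu_ mF mD; apply: (measurability _ (RGenOInfty.measurableE R)) => //.
move=> /= _ [_ [x ->] <-]; rewrite setTI.
rewrite [X in measurable X](_ : _ =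
    ~` ([set: W] `&` [set w | (u w)%:E <= mu w `]-oo, x]%classic]%E)).
  apply: measurableC; apply: measurable_lee => //.
  exact/measurable_EFinP.
rewrite setTI; apply/seteqP; split => w /=; rewrite in_itv /= andbT -quantile_le//.
  by rewrite ltNge => /negP.
by move/negP; rewrite -ltNge.
Qed.

End quantile.

Section discrepancy.
Context {R : realType}.
Implicit Types (mu nu : probability (measurableTypeR R) R).

Lemma probability_itv_outer mu (a b e : R) : 0 < e ->
  \forall n \near \oo, (mu `[(a - n.+1%:R^-1)%R, (b + n.+1%:R^-1)%R]%classic <=
    mu `[a, b]%classic + e%:E)%E.
Proof.
move=> e0.
pose F n : set (measurableTypeR R) := `[(a - n.+1%:R^-1)%R, (b + n.+1%:R^-1)%R]%classic.
have capF : \bigcap_n F n = `[a, b]%classic.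
  apply/seteqP; split => x /=; rewrite ?in_itv /=.
    move=> Fx; apply/andP; split; apply/ler_addgt0Pr => r r0.
      have [n _ nr] := near_infty_natSinv_lt (PosNum r0).
      have := Fx n Logic.I; rewrite /F /= in_itv /= => /andP[+ _].
      rewrite lerBlDr => /le_trans; apply; rewrite lerD2l.
      by have := nr n (leqnn n); rewrite /= => /ltW.
    have [n _ nr] := near_infty_natSinv_lt (PosNum r0).
    have := Fx n Logic.I; rewrite /F /= in_itv /= => /andP[_].
    move=> /le_trans; apply; rewrite lerD2l.
    by have := nr n (leqnn n); rewrite /= => /ltW.
  move=> /andP[ax xb] n _; rewrite /F /= in_itv /=.
  have n0 : 0 <= n.+1%:R^-1 :> R by rewrite invr_ge0.
  by move: (n.+1%:R^-1) n0 => r r0; apply/andP; split; lra.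
have : mu (F n) @[n --> \oo] --> mu (\bigcap_n F n).
  apply: nonincreasing_cvg_mu => //.
  - by rewrite -ge0_fin_numE// fin_num_measure//; exact: measurable_itv.
  - by move=> i; exact: measurable_itv.
  - by rewrite capF; exact: measurable_itv.
  - move=> m n mn; apply/subsetPset; apply: subset_itv; rewrite bnd_simp.
      by rewrite lerD2l lerN2 lef_pV2 ?posrE// ler_nat.
    by rewrite lerD2l lef_pV2 ?posrE// ler_nat.
rewrite capF => /(_ [set z | z <= mu `[a, b]%classic + e%:E]%E); apply.
have mfin : mu `[a, b]%classic \is a fin_num by exact: fin_num_measure.
rewrite -(fineK mfin) -EFinD.
apply: (@filterS _ _ _ [set z | z < (fine (mu `[a, b]%classic) + e)%:E]%E).
  by move=> z /= /ltW.
by apply: open_ereal_lt'; rewrite lte_fin ltrDl.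
Qed.

(** Closed intervals are limits from outside of intervals with rational ends, so the supremum
    reduces to countably many conditions; this is what makes accuracy a measurable event. *)
Lemma Dnorm_le_rat mu nu (k : R) :
  (Dnorm mu nu <= k%:E)%E <->
  (forall p q : rat, (ratr p < ratr q :> R) ->
   (`|mu `[ratr p, ratr q]%classic - nu `[ratr p, ratr q]%classic| <= k%:E)%E).
Proof.
split=> [le_k p q pq|le_k].
  apply: le_trans le_k; apply: ereal_sup_ubound => /=.
  by exists (ratr p, ratr q).
apply: ge_ereal_sup => _ [[a b] /= ab <-].
have fin (m : probability (measurableTypeR R) R) (x y : R) :
    m `[x, y]%classic \is a fin_num by exact: fin_num_measure.
rewrite -(fineK (fin mu a b)) -(fineK (fin nu a b)) -EFinB lee_fin.
apply/ler_addgt0Pr => e e0.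
(* A single enlargement costs at most [e] under both measures, and the rational interval is squeezed
   between the original and the enlarged one. *)
have [n [mun nun]] := @filter_ex _ \oo _ _
  (filterI (probability_itv_outer mu a b e0) (probability_itv_outer nu a b e0)).
have n0 : 0 < n.+1%:R^-1 :> R by rewrite invr_gt0.
move: (n.+1%:R^-1) n0 mun nun => r r0 mun nun.
have /rat_in_itvoo[p] : a - r < a by lra.
rewrite in_itv /= => /andP[ap pa].
have /rat_in_itvoo[q] : b < b + r by lra.
rewrite in_itv /= => /andP[bq qb].
have pq : ratr p < ratr q :> R by lra.
have := le_k p q pq.
have sub (m : probability (measurableTypeR R) R) :
    (m `[(a - r)%R, (b + r)%R]%classic <= m `[a, b]%classic + e%:E)%E ->
    fine (m `[a, b]%classic) <= fine (m `[ratr p, ratr q]%classic) <=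
      fine (m `[a, b]%classic) + e.
  move=> mle; apply/andP; split.
    apply: fine_le => //; apply: le_measure; rewrite ?inE//.
    by apply: subset_itv; rewrite bnd_simp ltW.
  rewrite -lee_fin EFinD !fineK//; apply: le_trans mle.
  apply: le_measure; rewrite ?inE//.
  by apply: subset_itv; rewrite bnd_simp ltW.
have /andP[m1 m2] := sub _ mun; have /andP[n1 n2] := sub _ nun.
rewrite -(fineK (fin mu (ratr p) (ratr q))) -(fineK (fin nu (ratr p) (ratr q))).
rewrite -EFinB lee_fin !ler_norml => /andP[h1 h2].
by apply/andP; split; lra.
Qed.

Lemma measurable_Dnorm_le d (W : measurableType d)
    (mu : W -> probability (measurableTypeR R) R) nu (k : R) :
  (forall a b : R, measurable_fun [set: W] (fun w => mu w `[a, b]%classic)) ->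
  measurable [set w | (Dnorm (mu w) nu <= k%:E)%E].
Proof.
move=> mm; rewrite [X in measurable X](_ : _ =
  \bigcap_(p : rat) \bigcap_(q : rat)
    [set w | ratr p < ratr q :> R ->
      (`|mu w `[ratr p, ratr q]%classic - nu `[ratr p, ratr q]%classic| <= k%:E)%E]).
  rewrite -[X in measurable X]setCK setC_bigcap; apply: measurableC.
  apply: bigcupT_measurable_rat => p.
  rewrite setC_bigcap; apply: bigcupT_measurable_rat => q; apply: measurableC.
  have [pq|pq] := boolP (ratr p < ratr q :> R); last first.
    by rewrite [X in measurable X](_ : _ = setT)//; apply/seteqP; split.
  rewrite [X in measurable X](_ : _ = [set: W] `&` [set w |
    (`|mu w `[ratr p, ratr q]%classic - nu `[ratr p, ratr q]%classic| <= k%:E)%E]).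
    apply: emeasurable_fun_infty_c => //; apply: measurableT_comp => //.
    exact: emeasurable_funB.
  by rewrite setTI; apply/seteqP; split => w /=; [apply|].
apply/seteqP; split => w /=.
  by move/Dnorm_le_rat => h p _ q _ pq; exact: h.
by move=> h; apply/Dnorm_le_rat => p q pq; exact: h.
Qed.

End discrepancy.

(** * Empirical measures of the particles *)

Section particle_measures.
Context {R : realType}.

Lemma weighted_dirac_prob N (w x : 'I_N -> R) :
  (forall n, 0 <= w n) -> \sum_n w n = 1 ->
  exists mu : probability (measurableTypeR R) R,
    (mu : set _ -> \bar R) = (fun A => \sum_n (w n)%:E * \d_(x n) A)%E.
Proof.
case: N w x => [|N] w x w0 w1.
  by move/eqP: w1; rewrite big_ord0 eq_sym oner_eq0.
(* [msum] is indexed by natural numbers, hence the conversion by [inord], possible once the index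
   type is nonempty. *)
pose m k : {measure set (measurableTypeR R) -> \bar R} :=
  mscale (NngNum (w0 (inord k))) (\d_(x (inord k) : measurableTypeR R)).
pose M : {measure set (measurableTypeR R) -> \bar R} := msum m N.+1.
have mE : (M : set _ -> \bar R) = (fun A => \sum_n (w n)%:E * \d_(x n) A)%E.
  apply/funext => A; rewrite /M /= /msum; apply: eq_bigr => n _.
  by rewrite /m /= /mscale /= inord_val.
have m1 : M setT = 1%E.
  rewrite mE -w1 -sumEFin; apply: eq_bigr => n _.
  by rewrite diracE in_setT mule1.
have [p pE] : exists p : probability (measurableTypeR R) R,
    (p : set _ -> \bar R) = normalized M.
  by apply: normalized_probability; rewrite m1 ltry lte01.
exists p; rewrite pE -mE; apply/funext => A.
by rewrite /normalized m1 /= invr1 mule1.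
Qed.

Variables (c : R) (N : nat).
Hypothesis N_gt0 : (0 < N)%N.

Lemma sum_potential_gt0 (X : 'I_N -> R) : 0 < \sum_(m < N) potential c (X m).
Proof.
case: N N_gt0 X => // N' _ X; rewrite big_ord_recl ltr_wpDr ?expR_gt0//.
by apply: sumr_ge0 => i _; exact: expR_ge0.
Qed.

Lemma weight_ge0 (X : 'I_N -> R) n : 0 <= weight c X n.
Proof. by rewrite divr_ge0 ?expR_ge0// ltW// sum_potential_gt0. Qed.

Lemma sum_weight (X : 'I_N -> R) : \sum_n weight c X n = 1.
Proof. by rewrite -mulr_suml divff// gt_eqF// sum_potential_gt0. Qed.

Lemma weighted_empirical_prob (X : 'I_N -> R) :
  exists mu : probability (measurableTypeR R) R,
    (mu : set _ -> \bar R) = weighted_empirical c X.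
Proof. exact: weighted_dirac_prob (weight_ge0 X) (sum_weight X). Qed.

Lemma empirical_prob (X : 'I_N -> R) :
  exists mu : probability (measurableTypeR R) R,
    (mu : set _ -> \bar R) = empirical X.
Proof.
have [||mu muE] := @weighted_dirac_prob N (fun=> N%:R^-1) X.
- by move=> n; rewrite invr_ge0.
- rewrite sumr_const card_ord -[LHS]mulr_natr mulVf//.
  by rewrite pnatr_eq0 -lt0n.
exists mu; rewrite muE; apply/funext => A.
by rewrite /empirical ge0_sume_distrr.
Qed.

Context d (W : measurableType d).
Variable X : W -> 'I_N -> R.
Hypothesis mX : forall n, measurable_fun [set: W] (X ^~ n).

Lemma measurable_dirac_comp n (A : set (measurableTypeR R)) : measurable A ->
  measurable_fun [set: W] (fun w => \d_(X w n) A : \bar R).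
Proof.
move=> mA.
exact: (measurableT_comp (@measurable_fun_dirac _ (measurableTypeR R) R setT A mA) (mX n)).
Qed.

Lemma measurable_empirical (A : set (measurableTypeR R)) : measurable A ->
  measurable_fun [set: W] (fun w => empirical (X w) A).
Proof.
move=> mA; apply: emeasurable_funM => //.
by apply: emeasurable_sum => n; exact: measurable_dirac_comp.
Qed.

Lemma measurable_weighted_empirical (A : set (measurableTypeR R)) : measurable A ->
  measurable_fun [set: W] (fun w => weighted_empirical c (X w) A).
Proof.
move=> mA; apply: emeasurable_sum => n; apply: emeasurable_funM; last first.
  exact: measurable_dirac_comp.
have mp m : measurable_fun [set: W] (fun w => potential c (X w m)).
  exact: (measurableT_comp (measurable_potential c) (mX m)).
(* The sum of potentials is positive, so its inverse is [expR] of minus its logarithm, a composition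
   of measurable functions. *)
apply/measurable_EFinP; rewrite [X in measurable_fun _ X](_ : _ = fun w =>
    potential c (X w n) * expR (- ln (\sum_(m < N) potential c (X w m)))).
  apply: measurable_funM => //; apply: measurableT_comp => //.
  apply: measurableT_comp => //; apply: measurableT_comp => //.
  exact: measurable_sum.
apply/funext => w; rewrite expRN lnK// posrE.
exact: sum_potential_gt0.
Qed.

End particle_measures.

(** * Measurability of the particle system *)

Section measurable_particles.
Context {R : realType} (rho sigma c : R).
Hypothesis sigma_gt0 : 0 < sigma.
Variable eta1 : probability (measurableTypeR R) R.
Variables (N : nat) (d : measure_display) (W : measurableType d).
Hypothesis N_gt0 : (0 < N)%N.
Variable U : nat -> 'I_N -> W -> measurableTypeR R * measurableTypeR R.

(** Only points up to time [t] have to be measurable, and [W] is arbitrary: the lemma thus applies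
    to the sigma-algebra of the past as well as to the full one. *)
Lemma measurable_particles t :
  (forall s n, (1 <= s <= t)%N -> measurable_fun [set: W] (U s n)) ->
  (forall s n w, (1 <= s)%N ->
     0 < (U s n w).1 < 1 /\ 0 < (U s n w).2 < 1) ->
  forall n, measurable_fun [set: W]
    (fun w => particles rho sigma c eta1 (fun s n => U s n w) t n).
Proof.
move=> + U01; elim: t => [|[|t] IH] mU n.
- exact: measurable_cst.
- apply: (@measurable_quantile _ _ _ (fun=> eta1)).
  + by move=> w; case: (U01 1%N n w isT).
  + by apply: measurableT_comp => //; exact: mU.
  + by move=> x; exact: measurable_cst.
have {}IH m := IH (fun s n st => mU s n (ltac:(by case/andP: st => -> /leqW))) m.
pose X w := particles rho sigma c eta1 (fun s n => U s n w) t.+1.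
(* A probability measure is chosen for each [w], because [measurable_quantile] takes a family of
   bundled ones. *)
pose mu w := sval (cid (weighted_empirical_prob c N_gt0 (X w))).
have muE w : (mu w : set _ -> \bar R) = weighted_empirical c (X w).
  exact: svalP (cid (weighted_empirical_prob c N_gt0 (X w))).
pose Xhat w := quantile (weighted_empirical c (X w)) (U t.+2 n w).1.
have mXhat : measurable_fun [set: W] Xhat.
  rewrite [Xhat](_ : _ = fun w => quantile (mu w) (U t.+2 n w).1); last first.
    by apply/funext => w; rewrite /Xhat muE.
  apply: measurable_quantile.
  + by move=> w; case: (U01 t.+2 n w isT).
  + by apply: measurableT_comp => //; apply: mU; rewrite leqnn.
  + move=> x; under eq_fun do rewrite muE.
    exact: measurable_weighted_empirical.
apply: (@measurable_quantile _ _ _ (fun w => mutation rho sigma (Xhat w))).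
+ by move=> w; case: (U01 t.+2 n w isT).
+ by apply: measurableT_comp => //; apply: mU; rewrite leqnn.
+ move=> x; apply: (measurableT_comp (measurable_kernel
    (mutation_pker rho sigma_gt0) `]-oo, x]%classic _) mXhat).
  exact: measurable_itv.
Qed.

End measurable_particles.

(** * Independence of the past *)

Section independence.
Context d (Omega : measurableType d) (R : realType) (P : probability Omega R).
Variables (N : nat)
  (U : nat -> 'I_N -> {RV P >-> (measurableTypeR R * measurableTypeR R)%type}).
Hypothesis iidU : iid_uniform_points U.
Local Open Scope ereal_scope.
Local Notation E := (measurableTypeR R * measurableTypeR R)%type.

Definition upto (t : nat) : set (nat * 'I_N) := [set i | (1 <= i.1 <= t)%N].

Definition box (t : nat) (B : nat * 'I_N -> set E) : set Omega :=
  \bigcap_(i in upto t) U i.1 i.2 @^-1` B i.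

(** A family stable under intersection; the sigma-algebra that it generates is the past up to time
    [t]. *)
Definition boxes (t : nat) : set (set Omega) :=
  [set A | exists2 B, (forall i, measurable (B i)) & A = box t B].

Definition slice (t : nat) (B : set E) : set Omega :=
  [set w | forall n, B (U t n w)].

Lemma measurable_slice t B : measurable B -> measurable (slice t B).
Proof.
move=> mB; rewrite [X in measurable X](_ : _ = \big[setI/setT]_(n < N) (U t n @^-1` B)).
  by apply: bigsetI_measurable => n _; exact: measurable_funPTI.
rewrite -bigcap_seq; apply/seteqP; split => w /=.
  by move=> h n _; exact: h.
by move=> h n; apply: h; rewrite /= mem_index_enum.
Qed.

(** The indices up to [t] are finitely many, so the product rule applies to all of them at once;
    times are listed as [k.+1] since they start at 1. *)
Lemma box_prob t B : (forall i, measurable (B i)) ->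
  P (box t B) = \prod_(s < t) \prod_n P (U s.+1 n @^-1` B (s.+1, n)).
Proof.
move=> mB; pose s := [seq (k.+1, n) | k <- iota 0 t, n <- enum 'I_N].
have us : uniq s.
  apply: allpairs_uniq; rewrite ?iota_uniq ?enum_uniq// => -[a b] [a' b'] _ _ /=.
  by move=> [-> ->].
pose J := [fset i in s]%fset.
have memJ i : (i \in J) = (1 <= i.1 <= t)%N.
  rewrite inE /=; apply/allpairsP/idP => /= [[[k n] /= [kt _ ->]]|].
    by move: kt; rewrite mem_iota /= add0n.
  case: i => -[|k] n //= kt; exists (k, n) => /=.
  by rewrite mem_iota mem_enum /= add0n.
have [_ _ ind] := iidU.
have -> : box t B = \bigcap_(i in [set` J]) U i.1 i.2 @^-1` B i.
  by congr bigcap; apply/seteqP; split => i /=; rewrite memJ.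
rewrite ind//; last by move=> i; rewrite /= memJ => /andP[].
rewrite (perm_big s) /=; last first.
  apply: uniq_perm => //; first exact: fset_uniq.
  by move=> i; rewrite inE.
rewrite big_allpairs_dep /= -[X in iota _ X]subn0 big_mkord.
by apply: eq_bigr => k _; rewrite big_enum.
Qed.

Lemma slice_box t B : measurable B ->
  slice t.+1 B = box t.+1 (fun i => if i.1 == t.+1 then B else setT).
Proof.
move=> mB; apply/seteqP; split => w /=.
  by move=> h [s n] _ /=; case: eqP => // ->; exact: h.
by move=> h n; have := h (t.+1, n); rewrite /upto /= leqnn eqxx; exact.
Qed.

Lemma slice_prob t B (b : R) : (1 <= t)%N -> measurable B ->
  uniform_square B = b%:E -> P (slice t B) = (b ^+ N)%:E.
Proof.
case: t => // t _ mB Bb; rewrite slice_box// box_prob; last first.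
  by move=> i; case: ifP.
have [_ dU _] := iidU.
rewrite big_ord_recr /= big1 ?mul1e; last first.
  move=> s _; rewrite big1// => n _.
  by rewrite eqSS ltn_eqF// preimage_setT probability_setT.
rewrite (eq_bigr (fun=> b%:E)) => [|n _]; last first.
  by rewrite eqxx -[LHS]/(distribution P _ B) dU.
by rewrite prodEFin prodr_const card_ord.
Qed.

Lemma box_setI t B C : box t B `&` box t C = box t (fun i => B i `&` C i).
Proof.
apply/seteqP; split => w /=.
  by move=> [hB hC] i ti; split; [exact: hB|exact: hC].
by move=> h; split => i ti; case: (h i ti).
Qed.

Lemma boxes_setI_closed t : setI_closed (boxes t).
Proof.
move=> _ _ [B mB ->] [C mC ->]; exists (fun i => B i `&` C i).
  by move=> i; exact: measurableI.
exact: box_setI.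
Qed.

Lemma measurable_box t B : (forall i, measurable (B i)) -> measurable (box t B).
Proof.
move=> mB; rewrite -[X in measurable X]setCK /box bigcap_mkcond setC_bigcap.
apply: measurableC; apply: countable_bigcupT_measurable => [|i].
  exact: countableP.
by apply: measurableC; case: ifP => // _; exact: measurable_funPTI.
Qed.

(** A past box cut by a slice at the next time is again a box, and the product over times splits at
    the last factor. *)
Lemma boxes_indep t A B : boxes t A -> measurable B ->
  P (A `&` slice t.+1 B) = P A * P (slice t.+1 B).
Proof.
move=> [C mC ->] mB.
have -> : box t C `&` slice t.+1 B = box t.+1 (fun i => if i.1 == t.+1 then B else C i).
  apply/seteqP; split => w /=.
    move=> [hC hB] [s n] /=; rewrite /upto /= => /andP[s1 st].
    case: eqP => [->|/eqP snt]; first exact: hB.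
    by apply: (hC (s, n)); rewrite /upto /= s1 -ltnS ltn_neqAle snt.
  move=> h; split.
    move=> [s n] /=; rewrite /upto /= => /andP[s1 st].
    have := h (s, n); rewrite /upto /= s1 (leqW st) (ltn_eqF (_ : s < t.+1)%N)//.
    by apply.
  by move=> n; have := h (t.+1, n); rewrite /upto /= leqnn eqxx; exact.
rewrite (slice_box t mB) !box_prob//; last 2 first.
- by move=> i; case: ifP.
- by move=> i; case: ifP.
rewrite !big_ord_recr /=; congr (_ * _).
  by apply: eq_bigr => s _; apply: eq_bigr => n _; rewrite eqSS ltn_eqF.
rewrite [X in _ = X * _]big1 ?mul1e.
  by apply: eq_bigr => n _; rewrite eqxx.
move=> s _; rewrite big1// => n _.
by rewrite eqSS ltn_eqF// preimage_setT probability_setT.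
Qed.

(** Dynkin argument: the events satisfying both conclusions are closed under proper differences and
    increasing unions, and they contain the generating [boxes]. *)
Lemma past_indep t A B : <<s boxes t>> A -> measurable B ->
  measurable A /\ P (A `&` slice t.+1 B) = P A * P (slice t.+1 B).
Proof.
move=> sA mB; set F := slice t.+1 B.
have mF : measurable F by exact: measurable_slice.
pose H := [set A | measurable A /\ P (A `&` F) = P A * P F].
suff : <<s boxes t>> `<=` H by exact.
apply: lambda_system_subset => //.
- exact: boxes_setI_closed.
- split => //.
  + by split => //; rewrite setTI probability_setT mul1e.
  + move=> X Y YX [mX hX] [mY hY]; split; first exact: measurableD.
    have -> : (X `\` Y) `&` F = (X `&` F) `\` (Y `&` F).
      by apply/seteqP; split => w /=; tauto.
    have fin (A0 : set Omega) : measurable A0 -> P A0 < +oo.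
      by move=> mA0; rewrite -ge0_fin_numE// fin_num_measure.
    rewrite !measureD ?fin//; do ?exact: measurableI.
    rewrite (setIidr YX) (setIidr (@setSI _ F _ _ YX)).
    transitivity (P X * P F - P Y * P F); first by congr (_ - _).
    rewrite muleBl ?fin_num_measure//.
    by rewrite fin_num_adde_defl// fin_numN fin_num_measure.
  + move=> G ndG HG.
    have mG i : measurable (G i) by case: (HG i).
    have mUG : measurable (\bigcup_i G i) by exact: bigcup_measurable.
    split => //.
    have c1 : P (G n `&` F) @[n --> \oo] --> P (\bigcup_i G i `&` F).
      rewrite setI_bigcupl; apply: nondecreasing_cvg_mu.
      * by move=> i; exact: measurableI.
      * by apply: bigcup_measurable => i _; exact: measurableI.
      * by move=> m n mn; apply/subsetPset; apply: setSI; apply/subsetPset; exact: ndG.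
    have c2 : P (G n) * P F @[n --> \oo] --> P (\bigcup_i G i) * P F.
      apply: cvgeZr; first exact: fin_num_measure.
      exact: nondecreasing_cvg_mu.
    rewrite (_ : (fun n => P (G n `&` F)) = (fun n => P (G n) * P F)) in c1.
      exact: cvg_unique c1 c2.
    by apply/funext => n; case: (HG n).
- by move=> X GX; split; [by case: GX => C mC ->; exact: measurable_box|exact: boxes_indep].
Qed.

Lemma measurable_past t s n : (1 <= s <= t)%N ->
  measurable_fun [set: g_sigma_algebraType (boxes t)] (U s n : _ -> E).
Proof.
move=> st _ B mB; rewrite setTI; apply: sub_sigma_algebra.
exists (fun i => if i == (s, n) then B else setT); first by move=> i; case: ifP.
apply/seteqP; split => w /=.
  by move=> Bw [s' n'] _ /=; case: eqP => // -[-> ->].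
by move=> /(_ (s, n)); rewrite /upto /= eqxx; exact.
Qed.

End independence.

(** * Collapse of the particle cloud *)

Section collapse.
Context {R : realType}.

(** Substitution by the translation [F]. It makes one range of mutation variables suitable for every
    starting point. *)
Lemma normal_prob_shift (m s y : R) : s != 0 ->
  normal_prob m s `]-oo, (m + y)%R]%classic = normal_prob 0 s `]-oo, y]%classic.
Proof.
move=> s0; rewrite /normal_prob.
pose F (x : R) := m + x.
have F'E : F^`()%classic = cst 1.
  by apply/funext => x; rewrite /F derive1E deriveD// derive_cst add0r derive_id.
have cF : continuous F.
  by move=> x; apply: (@cvgD _ R^o); [exact: cvg_cst|exact: cvg_id].
rewrite -[m + y]/(F y) increasing_ge0_integration_by_substitutionNy.
- apply: eq_integral => x _; rewrite F'E /= !fctE mulr1; congr EFin.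
  by rewrite !normal_pdfE// /normal_fun /F addrAC subrr add0r subr0.
- by move=> a b _ _; rewrite /F ltrD2l.
- by rewrite F'E => ? _; exact: cvg_cst.
- by rewrite F'E; exact: is_cvg_cst.
- by rewrite F'E; exact: cvg_cst.
- split=> [x _|]; first by apply: derivableD.
  exact/cvg_at_left_filter/cF.
- by apply: cvg_addrl_Ny.
- apply: continuous_subspaceT => x; exact: continuous_normal_pdf.
- by move=> x _; exact: normal_pdf_ge0.
Qed.

Lemma normal_prob_lt (s l : R) : s != 0 -> 0 < l ->
  (normal_prob 0 s `]-oo, 0%R]%classic < normal_prob 0 s `]-oo, l]%classic)%E.
Proof.
move=> s0 l0; pose p := normal_prob 0 s : probability (measurableTypeR R) R.
have -> : `]-oo, l]%classic = `]-oo, 0]%classic `|` `]0, l]%classic :> set R.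
  rewrite -itv_bndbnd_setU// bnd_simp; exact: ltW.
have -> : normal_prob 0 s (`]-oo, 0]%classic `|` `]0, l]%classic) =
    (p `]-oo, 0%R]%classic + p `]0%R, l]%classic)%E.
  rewrite -[LHS]/(p _) measureU//.
  apply/seteqP; split => x //=; rewrite !in_itv /= => -[x0 /andP[x1 _]].
  by move: x1; rewrite ltNge x0.
rewrite lteDl; last exact: fin_num_measure.
pose k := normal_pdf 0 s l.
have k0 : 0 < k by rewrite /k normal_pdfE// mulr_gt0 ?normal_peak_gt0 ?expR_gt0.
apply: (@lt_le_trans _ _ (\int[lebesgue_measure]_(x in `]0%R, l]%classic) k%:E)%E).
  rewrite integral_cst//= lebesgue_measure_itv /= lte_fin l0 -EFinB -EFinM.
  by rewrite lte_fin mulr_gt0 ?subr0.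
apply: ge0_le_integral => //.
- by move=> x _; rewrite lee_fin ltW.
- apply: measurable_funTS; apply/measurable_EFinP.
  exact: measurable_normal_pdf.
- move=> x /=; rewrite in_itv /= => /andP[x0 xl].
  rewrite lee_fin /k !normal_pdfE// ler_wpM2l ?normal_peak_ge0// ler_expR !subr0.
  rewrite ler_wpM2r ?invr_ge0 ?mulrn_wge0 ?sqr_ge0// lerN2.
  by rewrite lerXn2r ?nnegrE ?(ltW x0) ?(ltW l0).
Qed.

Lemma uniform_prob_itv (a b : R) : 0 <= a -> a < b -> b <= 1 ->
  uniform_prob (@ltr01 R) `]a, b]%classic = (b - a)%:E.
Proof.
move=> a0 ab b1; rewrite /uniform_prob integral_uniform_pdf setIidl; last first.
  move=> x /=; rewrite !in_itv /= => /andP[ax xb].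
  by rewrite (le_trans a0 (ltW ax)) (le_trans xb b1).
transitivity (\int[lebesgue_measure]_(x in `]a, b]%classic) (cst 1%:E x))%E.
  apply: eq_integral => x; rewrite inE /= in_itv /= => /andP[ax xb].
  rewrite /uniform_pdf subr0 invr1 ifT//.
  by rewrite (le_trans a0 (ltW ax)) (le_trans xb b1).
by rewrite integral_cst//= mul1e lebesgue_measure_itv /= lte_fin ab.
Qed.

Lemma uniform_square_rect (a b a' b' : R) : 0 <= a -> a < b -> b <= 1 ->
  0 <= a' -> a' < b' -> b' <= 1 ->
  uniform_square (`]a, b]%classic `*` `]a', b']%classic) = ((b - a) * (b' - a'))%:E.
Proof.
move=> *; rewrite /uniform_square product_measure1E// EFinM.
by congr (_ * _)%E; exact: uniform_prob_itv.
Qed.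

(** By pigeonhole some increment of [H] is at least [e / m], hence at least [2 / K]. A length of two
    meshes always contains one full cell, however the grid is aligned. *)
Lemma increment_cell (m K : nat) (H : nat -> R) (e : R) :
  (0 < m)%N -> (forall i, 0 <= H i <= 1) -> e <= H m - H 0%N ->
  0 < e -> 2 * m%:R <= K%:R * e ->
  exists i j, [/\ (i < m)%N, (j < K)%N, H i <= j%:R / K%:R &
    j.+1%:R / K%:R <= H i.+1].
Proof.
move=> m0 H01 eH e0 mK.
have m0R : 0 < m%:R :> R by rewrite ltr0n.
have K0 : 0 < K%:R :> R.
  have : 0 < K%:R * e by rewrite (lt_le_trans _ mK)// mulr_gt0.
  by rewrite pmulr_lgt0.
have [i im iH] : exists2 i, (i < m)%N & e / m%:R <= H i.+1 - H i.
  apply/not_exists2P => h.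
  have : \sum_(0 <= i < m) (H i.+1 - H i) < \sum_(0 <= i < m) (e / m%:R).
    apply: ltr_sum_nat => // i /andP[_ im].
    by have [//|/negP] := h i; rewrite ltNge => ->.
  rewrite telescope_sumr// sumr_const_nat subn0 -[X in _ < X]mulr_natr divfK ?gt_eqF//.
  by rewrite ltNge eH.
have KH0 : 0 <= K%:R * H i by rewrite mulr_ge0 ?(ltW K0)//; case/andP: (H01 i).
have /andP[j1 j2] := truncn_itv KH0.
set j := Num.truncn _ in j1 j2.
have step : 2 <= K%:R * (H i.+1 - H i).
  apply: (@le_trans _ _ (K%:R * (e / m%:R))); last by rewrite ler_wpM2l ?(ltW K0).
  by rewrite mulrA ler_pdivlMr.
(* Since [j] is the integer part of [K * H i], the first grid point after [H i] is [j.+1]; the cell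
   retained goes from there to [j.+2]. *)
have jH : j.+2%:R <= K%:R * H i.+1.
  by rewrite -[j.+2]addn2 natrD; move: step; rewrite mulrBr; lra.
exists i, j.+1; split => //.
- rewrite -(ltr_nat R) -(@ltr_pM2r _ K%:R^-1) ?invr_gt0// divff ?gt_eqF//.
  apply: (@lt_le_trans _ _ (j.+2%:R / K%:R)).
    by rewrite ltr_pM2r ?invr_gt0// ltr_nat.
  rewrite ler_pdivrMr// mul1r (le_trans jH)// ler_piMr ?(ltW K0)//.
  by case/andP: (H01 i.+1).
- by rewrite ler_pdivlMr// mulrC ltW.
- by rewrite ler_pdivrMr// mulrC.
Qed.

End collapse.

(** * Numerical bound linking the number of particles to the horizon *)

Lemma success_bound {R : realType} (q0 q : R) (T N : nat) :
  0 < q0 -> q0 < 1 -> 0 < q -> q < 1 / 2 -> (8 <= T)%N ->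
  N%:R < (2 * ln q0^-1)^-1 * ln (T%:R / q) ->
  (1 - q0 ^+ N) ^+ T.-1 < 1 - q.
Proof.
move=> q00 q01 q_gt0 q_lt T8 NC.
have L0 : 0 < ln q0^-1 by rewrite ln_gt0// invf_gt1.
have T0 : 8 <= T%:R :> R by rewrite ler_nat.
set y := q0 ^+ N.
have y1 : y <= 1 by rewrite exprn_ile1// ltW.
have Tq0 : 0 < T%:R / q by rewrite divr_gt0//; lra.
(* This is the square root of [q / T]; the bound on [N] says exactly that [q0 ^+ N] exceeds it. *)
pose r := expR (- (ln (T%:R / q) / 2)).
have r0 : 0 < r := expR_gt0 _.
have r2 : r ^+ 2 = q / T%:R.
  rewrite -expRM_natl mulrN mulrC divfK// expRN lnK ?posrE//.
  by rewrite invf_div.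
have ry : r < y.
  have -> : y = expR (- (N%:R * ln q0^-1)).
    by rewrite lnV ?posrE// mulrN opprK expRM_natl lnK ?posrE.
  rewrite ltr_expR ltrN2; move: NC.
  rewrite invfM -mulrA mulrCA ltr_pdivlMl// => NC.
  by rewrite mulrC [ltRHS]mulrC.
have TE : T%:R = T.-1%:R + 1 :> R.
  by rewrite natr1 prednK//; apply: leq_trans T8.
(* Squared, this reads [16 * q <= T], which holds because [q < 1 / 2] and [8 <= T]. *)
have rT : 2 * q <= r * T%:R / 2.
  rewrite -(@ler_pXn2r _ 2) ?nnegrE//; last 2 first.
  - by rewrite mulr_ge0 ?ltW.
  - by rewrite divr_ge0 ?mulr_ge0 ?(ltW r0).
  rewrite !exprMn r2 exprVn.
  have -> : q / T%:R * T%:R ^+ 2 / 2 ^+ 2 = q * T%:R / 4.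
    by field; rewrite gt_eqF//; lra.
  nra.
have yT : 2 * q < y * T.-1%:R.
  have : r * T.-1%:R < y * T.-1%:R by rewrite ltr_pM2r//; lra.
  apply: le_lt_trans; apply: (le_trans rT).
  rewrite -mulrA ler_wpM2l ?(ltW r0)//; lra.
apply: (@le_lt_trans _ _ (expR (- y) ^+ T.-1)).
  by rewrite lerXn2r ?nnegrE ?expR_ge0 ?subr_ge0// expR_ge1Dx.
rewrite -expRM_natl.
apply: (@lt_le_trans _ _ (expR (- (2 * q)))).
  by rewrite ltr_expR mulrN ltrN2 [ltRHS]mulrC.
(* It suffices that [(1 - q) * (1 + 2 * q) >= 1], which is where [q < 1 / 2] enters. *)
rewrite expRN -[leLHS]mul1r ler_pdivrMr ?expR_gt0//.
have := expR_ge1Dx (2 * q) => h.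
have : (1 - q) * (1 + 2 * q) <= (1 - q) * expR (2 * q) by rewrite ler_wpM2l//; lra.
apply: le_trans; nra.
Qed.

(** * Constants of the collapse, uniform in time *)

Section collapse_step.
Context {R : realType} (rho sigma c : R).
Hypotheses (sigma_gt0 : 0 < sigma) (c_gt0 : 0 < c).
Variable eta1 : probability (measurableTypeR R) R.
Variable kappa : R.
Hypothesis kappa_lt1 : kappa < 1.

Local Notation updated := (updated rho sigma c eta1).
Local Notation predicted := (predicted rho sigma c eta1).
Local Notation mutation := (mutation rho sigma).

(** Two values of the distribution function encode that quantiles of all levels in []u, v]] inside
    []0, 1[] lie in []a, b]]; such a condition defines a measurable event. *)
Definition jumps (mu : set (measurableTypeR R) -> \bar R) (a b u v : R) : Prop :=
  (mu `]-oo, a]%classic <= u%:E)%E /\ (v%:E <= mu `]-oo, b]%classic)%E.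

Lemma quantile_jumps (mu : probability (measurableTypeR R) R) a b u v w :
  jumps mu a b u v -> u < w -> w <= v -> 0 < w < 1 -> a < quantile mu w <= b.
Proof.
move=> [ua vb] uw wv w01; apply/andP; split; last first.
  by rewrite quantile_le// (le_trans _ vb)// lee_fin.
by rewrite ltNge quantile_le// -ltNge (le_lt_trans ua)// lte_fin.
Qed.

(** All constants are fixed before the time, the number of particles and the random points, so the
    collapse probability derived from them is uniform. *)
Lemma collapse_data : exists (l v0 v1 : R) (x : nat -> R) (m K : nat),
  [/\ [/\ 0 < l, 0 <= v0, v0 < v1, v1 <= 1 & (0 < m)%N && (0 < K)%N],
      forall i, x i <= x i.+1 /\ `|rho| * (x i.+1 - x i) <= l,
      normal_peak sigma * (3 * l) < 1 - kappa,
      forall z, jumps (mutation z) (rho * z) (rho * z + l) v0 v1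
    & forall t (mu : probability (measurableTypeR R) R), (1 <= t)%N ->
      (Dnorm mu (updated t) <= kappa%:E)%E ->
      exists i j, [/\ (i < m)%N, (j < K)%N &
        jumps mu (x i) (x i.+1) (j%:R / K%:R) (j.+1%:R / K%:R)]].
Proof.
have s0 : sigma != 0 by rewrite gt_eqF.
have pk0 := normal_peak_gt0 s0.
(* The exact filter puts mass [1 - e] on the compact interval, so a [kappa]-accurate measure puts at
   least [1 - e - kappa = e] there. *)
pose e := (1 - kappa) / 2.
have e0 : 0 < e by rewrite divr_gt0// subr_gt0.
have [B B0 HB] := updated_tight rho sigma_gt0 c_gt0 eta1 e0.
(* A window of length [3 * l] then has predicted mass at most [(1 - kappa) / 2]. *)
pose l := (1 - kappa) / (6 * normal_peak sigma).
have l0 : 0 < l by rewrite divr_gt0 ?mulr_gt0// subr_gt0.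
pose h := l / (`|rho| + 1).
have rho1 : 0 < `|rho| + 1 by rewrite ltr_wpDl.
have h0 : 0 < h by rewrite divr_gt0.
(* The grid starts strictly left of [- B], so the half-line up to [x 0] misses the compact interval,
   and [m] is large enough for [x m] to pass [B]. *)
pose x (i : nat) : R := - B - 1 + i%:R * h.
have xS i : x i.+1 - x i = h by rewrite /x -natr1; ring.
pose m := (Num.truncn ((2 * B + 1) / h)).+1.
have mB : 2 * B + 1 < m%:R * h.
  by rewrite -ltr_pdivrMr//; exact: truncnS_gt.
pose K := (Num.truncn (2 * m%:R / e)).+1.
have Ke : 2 * m%:R < K%:R * e.
  by rewrite -ltr_pdivrMr//; exact: truncnS_gt.
pose p0 : probability (measurableTypeR R) R := normal_prob 0 sigma.
pose Phi y := p0 `]-oo, y]%classic.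
have Phifin y : Phi y \is a fin_num by exact: fin_num_measure.
have shiftE z y : mutation z `]-oo, (rho * z + y)%R]%classic = Phi y.
  exact: normal_prob_shift.
exists l, (fine (Phi 0)), (fine (Phi l)), x, m, K; split.
- split => //.
  + by rewrite fine_ge0//; exact: measure_ge0.
  + by rewrite -lte_fin !fineK//; exact: normal_prob_lt.
  + by rewrite -lee_fin fineK//; exact: probability_le1.
- move=> i; rewrite -subr_ge0 xS; split; first exact: ltW.
  rewrite /h mulrA ler_pdivrMr// mulrC ler_wpM2l ?(ltW l0)// lerDl//.
- rewrite /l.
  have -> : normal_peak sigma * (3 * ((1 - kappa) / (6 * normal_peak sigma))) = (1 - kappa) / 2.
    by field; rewrite gt_eqF.
  by rewrite ltr_pdivrMr//; move: (kappa_lt1) => ?; lra.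
- move=> z; split.
    by rewrite fineK// -(shiftE z 0) addr0.
  by rewrite fineK// (shiftE z l).
- move=> t mu t1 Dle; pose H i := fine (mu `]-oo, x i]%classic).
  have fin A : measurable A -> mu A \is a fin_num by move=> mA; exact: fin_num_measure.
  have [nu nuE] := updated_prob rho sigma_gt0 c_gt0 eta1 t.
  have muB : (kappa%:E + mu `[(- B)%R, B]%classic >= (1 - e)%:E)%E.
    have nufin : nu `[(- B)%R, B]%classic \is a fin_num by exact: fin_num_measure.
    have : (`|mu `[(- B)%R, B]%classic - nu `[(- B)%R, B]%classic| <= kappa%:E)%E.
      apply: le_trans Dle; rewrite -nuE; apply: ereal_sup_ubound => /=.
      by exists (- B, B) => //=; lra.
    have := HB t t1; rewrite -nuE.
    rewrite -(fineK nufin) -(fineK (fin `[(- B)%R, B]%classic _))//.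
    rewrite -EFinB -EFinD !lee_fin ler_norml => h1 /andP[h2 h3]; lra.
  have [|||||i [j [im jK Hi Hj]]] := @increment_cell R m K H e.
  + by [].
  + move=> i; rewrite /H -!lee_fin fineK; last exact: fin.
    by rewrite measure_ge0 probability_le1.
  + have : (mu `]-oo, x 0%N]%classic + mu `[(- B)%R, B]%classic <= mu `]-oo, x m]%classic)%E.
      rewrite -measureU//; last first.
        apply/seteqP; split => y //=; rewrite !in_itv /= /x mul0r addr0 => -[y1 /andP[y2 _]].
        by lra.
      apply: le_measure; rewrite ?inE//; first exact: measurableU.
      move=> y /=; rewrite !in_itv /= /x mul0r addr0.
      by case=> [y1|/andP[_ y2]]; lra.
    move: muB; rewrite /H.
    rewrite -(fineK (fin `]-oo, x 0%N]%classic _))// -(fineK (fin `[(- B)%R, B]%classic _))//.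
    rewrite -(fineK (fin `]-oo, x m]%classic _))// -!EFinD !lee_fin /e => h1 h2.
    by rewrite /=; lra.
  + by [].
  + exact: ltW.
  exists i, j; split => //; split.
    by rewrite -[leLHS]fineK ?lee_fin//; exact: fin.
  by rewrite -[leRHS]fineK ?lee_fin//; exact: fin.
Qed.

End collapse_step.

(** * Success events and their loss of probability at each step *)

Section step.
Context {R : realType} (rho sigma c : R).
Hypotheses (sigma_gt0 : 0 < sigma) (c_gt0 : 0 < c).
Variable eta1 : probability (measurableTypeR R) R.
Variable kappa : R.
Hypothesis kappa_lt1 : kappa < 1.

Local Notation updated := (updated rho sigma c eta1).
Local Notation predicted := (predicted rho sigma c eta1).
Local Notation mutation := (mutation rho sigma).
Local Notation E := (measurableTypeR R * measurableTypeR R)%type.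
Local Notation run V w := (particles rho sigma c eta1 (fun s n => V s n w)).

(** The space and the points are left general so that the event can be measured with respect to the
    past alone. *)
Definition success (W : Type) (N : nat) (V : nat -> 'I_N -> W -> E) (t : nat) : set W :=
  [set w | forall s, (1 <= s <= t)%N ->
    (Dnorm (weighted_empirical c (run V w s)) (updated s) <= kappa%:E)%E /\
    (Dnorm (empirical (run V w s)) (predicted s) <= kappa%:E)%E].

Section measurability.
Context d (W : measurableType d) (N : nat) (V : nat -> 'I_N -> W -> E) (t : nat).
Hypothesis N_gt0 : (0 < N)%N.
Hypothesis mV : forall s n, (1 <= s <= t)%N -> measurable_fun [set: W] (V s n).
Hypothesis V01 : forall s n w, (1 <= s)%N ->
  0 < (V s n w).1 < 1 /\ 0 < (V s n w).2 < 1.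

Let mX s n : (s <= t)%N -> measurable_fun [set: W] (fun w => run V w s n).
Proof.
move=> st; apply: measurable_particles => // r m /andP[r0 rs].
by apply: mV; rewrite r0 (leq_trans rs).
Qed.

(* Needed because a measure takes unspecified values on non-measurable sets. *)
Lemma measurable_success : measurable (success V t).
Proof.
pose A s := [set w | (1 <= s <= t)%N ->
  (Dnorm (weighted_empirical c (run V w s)) (updated s) <= kappa%:E)%E /\
  (Dnorm (empirical (run V w s)) (predicted s) <= kappa%:E)%E].
rewrite (_ : success V t = \bigcap_s A s); last first.
  apply/seteqP; split => w /= h; first by move=> s _; exact: h.
  by move=> s; exact: (h s Logic.I).
apply: bigcapT_measurable => s.
have [/andP[s0 st]|nst] := boolP (1 <= s <= t)%N; last first.
  rewrite [X in measurable X](_ : _ = setT)//.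
  by apply/seteqP; split => // w _ /= h; rewrite h in nst.
have [nu nuE] := updated_prob rho sigma_gt0 c_gt0 eta1 s.
have [nu' nuE'] := predicted_prob rho sigma_gt0 c_gt0 eta1 s.
pose mu w := sval (cid (weighted_empirical_prob c N_gt0 (run V w s))).
have muE w : (mu w : set _ -> \bar R) = weighted_empirical c (run V w s).
  exact: svalP (cid (weighted_empirical_prob c N_gt0 (run V w s))).
pose mu' w := sval (cid (empirical_prob N_gt0 (run V w s))).
have muE' w : (mu' w : set _ -> \bar R) = empirical (run V w s).
  exact: svalP (cid (empirical_prob N_gt0 (run V w s))).
rewrite (_ : A s = [set w | (Dnorm (mu w) nu <= kappa%:E)%E] `&`
                   [set w | (Dnorm (mu' w) nu' <= kappa%:E)%E]); last first.
  apply/seteqP; split => w; rewrite /A /= muE muE' nuE nuE' => h; last by [].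
  by apply: h; rewrite s0.
apply: measurableI; apply: measurable_Dnorm_le => a b.
  under eq_fun do rewrite muE.
  by apply: measurable_weighted_empirical => // n; exact: mX.
under eq_fun do rewrite muE'.
by apply: measurable_empirical => // n; exact: mX.
Qed.

Lemma measurable_jumps a b u v : measurable
  [set w | jumps (weighted_empirical c (run V w t)) a b u v].
Proof.
have mF x : measurable_fun [set: W]
    (fun w => weighted_empirical c (run V w t) `]-oo, x]%classic).
  by apply: measurable_weighted_empirical => // n; exact: mX.
rewrite [X in measurable X](_ : _ =
  ([set: W] `&` [set w | weighted_empirical c (run V w t) `]-oo, a]%classic <= u%:E]%E) `&`
  ([set: W] `&` [set w | v%:E <= weighted_empirical c (run V w t) `]-oo, b]%classic]%E)).
  by apply: measurableI; [exact: emeasurable_fun_infty_c|exact: emeasurable_fun_c_infty].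
by apply/seteqP; split => w /=; rewrite /jumps; tauto.
Qed.

End measurability.

Lemma particlesS N (u : nat -> 'I_N -> R * R) t n : (1 <= t)%N ->
  particles rho sigma c eta1 u t.+1 n =
  quantile (mutation (quantile (weighted_empirical c
    (particles rho sigma c eta1 u t)) (u t.+1 n).1)) (u t.+1 n).2.
Proof. by case: t. Qed.

Lemma empirical_full (N : nat) (X : 'I_N -> R) (A : set (measurableTypeR R)) :
  (0 < N)%N -> (forall n, A (X n)) -> empirical X A = 1%E.
Proof.
move=> N0 AX; rewrite /empirical (eq_bigr (fun=> 1%:E)) => [|n _]; last first.
  by rewrite diracE mem_set.
rewrite sumEFin sumr_const card_ord -EFinM mulVf//.
by rewrite pnatr_eq0 -lt0n.
Qed.

(** The window has empirical mass 1 but predicted mass below [1 - kappa]. *)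
Lemma Dnorm_concentrated (N t : nat) (X : 'I_N -> R) (a l : R) :
  (0 < N)%N -> (2 <= t)%N -> 0 < l -> normal_peak sigma * l < 1 - kappa ->
  (forall n, a <= X n <= a + l) ->
  (kappa%:E < Dnorm (empirical X) (predicted t))%E.
Proof.
move=> N0 t2 l0 lk aX.
have [nu nuE] := predicted_prob rho sigma_gt0 c_gt0 eta1 t.
have nufin : nu `[a, (a + l)%R]%classic \is a fin_num by exact: fin_num_measure.
have := predicted_itv_le rho sigma_gt0 c_gt0 eta1 a t2 (ltW l0).
rewrite -nuE -(fineK nufin) lee_fin => hle.
apply: (@lt_le_trans _ _ (`|empirical X `[a, (a + l)%R]%classic - nu `[a, (a + l)%R]%classic|)%E).
  rewrite empirical_full//.
  rewrite -(fineK nufin) -EFinB lte_fin (lt_le_trans _ (ler_norm _))//.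
  lra.
apply: ereal_sup_ubound => /=; exists (a, a + l) => //=.
by rewrite ltrDl.
Qed.

(** The cell that works depends on the past, whereas independence requires a fixed one. Success at
    time [t] is therefore covered by [m * K] past events, one per piece and cell, and the likeliest
    is kept. *)
Lemma success_step : exists q0 : R, [/\ 0 < q0, q0 < 1 &
  forall d (Omega : measurableType d) (P : probability Omega R)
    (N : nat) (U : nat -> 'I_N -> {RV P >-> E}) (t : nat),
  (0 < N)%N -> iid_uniform_points U -> (1 <= t)%N ->
  (P (success (fun s n => U s n : Omega -> E) t.+1) <=
   (1 - q0 ^+ N)%:E * P (success (fun s n => U s n : Omega -> E) t))%E].
Proof.
have [l [v0 [v1 [x [m [K [[l0 v00 v01 v11 /andP[m0 K0]] xl lk mutj jump]]]]]]] :=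
  collapse_data rho sigma_gt0 c_gt0 eta1 kappa_lt1.
pose p : R := K%:R^-1 * (v1 - v0).
have K0R : 0 < K%:R :> R by rewrite ltr0n.
have p0 : 0 < p by rewrite mulr_gt0 ?invr_gt0// subr_gt0.
have p1 : p <= 1.
  rewrite -[leRHS]mul1r ler_pM ?invr_ge0 ?(ltW K0R) ?subr_ge0 ?(ltW v01)//.
    by rewrite invf_le1// ler1n.
  lra.
pose mK := (m * K)%N.
have mK0n : (0 < mK)%N by rewrite muln_gt0 m0.
have mK0 : 0 < mK%:R :> R by rewrite ltr0n.
have mK1 : 1 <= mK%:R :> R by rewrite ler1n muln_gt0 m0.
(* [p ^+ N] is the probability of one cell and [mK%:R^-1] the price for choosing
   the likeliest cell, absorbed in the [N]-th power since [N >= 1]; halving only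
   ensures [q0 < 1]. *)
exists (p / mK%:R / 2).
have q1 : p / mK%:R <= 1.
  by rewrite ler_pdivrMr// mul1r (le_trans p1).
have q0 : 0 < p / mK%:R by rewrite divr_gt0.
have q2 : p / mK%:R / 2 <= p / mK%:R by lra.
split; [by rewrite divr_gt0|by lra|].
move=> d Omega P N U t N0 iidU t1.
have [U01 _ _] := iidU.
set S := success _.
(* The pair of a piece [i] and a cell [j] is encoded as [k = i * K + j]. *)
pose J (k : nat) := [set w : Omega | jumps (weighted_empirical c
    (run (fun s n => U s n : Omega -> E) w t)) (x (k %/ K)%N) (x (k %/ K).+1)
    ((k %% K)%N%:R / K%:R) ((k %% K).+1%:R / K%:R)].
pose D k := S t `&` J k.
pose B (k : nat) : set E :=
  `](k %% K)%N%:R / K%:R, (k %% K).+1%:R / K%:R]%classic `*` `]v0, v1]%classic.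
have mB k : measurable (B k) by apply: measurableX; exact: measurable_itv.
have past A : <<s boxes U t>> A -> measurable A.
  by move=> sA; have [] := past_indep iidU sA (mB 0%N).
(* Measurability is proved in the space carrying the sigma-algebra of the past, which places the
   event within reach of [past_indep]. *)
have pS : <<s boxes U t>> (S t).
  apply: (measurable_success (W := g_sigma_algebraType (boxes U t))) => // s n st.
  exact: measurable_past.
have pJ k : <<s boxes U t>> (J k).
  apply: (measurable_jumps (W := g_sigma_algebraType (boxes U t))) => // s n st.
  exact: measurable_past.
have pD k : <<s boxes U t>> (D k).
  exact: (@measurableI _ (g_sigma_algebraType (boxes U t)) _ _ pS (pJ k)).
have mS s : measurable (S s).
  by apply: measurable_success.
have unifB k : uniform_square (B k) = p%:E.
  have kK : (k %% K < K)%N by rewrite ltn_mod.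
  rewrite /B uniform_square_rect//.
  - congr (_ * _)%:E; rewrite -mulrBl -natr1.
    by rewrite addrAC subrr add0r mul1r.
  - by rewrite ltr_pM2r ?invr_gt0// ltr_nat.
  - by rewrite ler_pdivrMr// mul1r ler_nat.
have SD : S t `<=` \big[setU/set0]_(k < mK) D k.
  move=> w Sw; rewrite -bigcup_mkord.
  have [mu muE] := weighted_empirical_prob c N0 (run (fun s n => U s n : Omega -> E) w t).
  have [hw _] := Sw t (introT andP (conj t1 (leqnn t))).
  rewrite -muE in hw.
  have [i [j [im jK ij]]] := jump t mu t1 hw.
  exists (i * K + j)%N => /=.
    rewrite /mK; apply: (@leq_trans (i.+1 * K)%N); last by rewrite leq_mul2r im orbT.
    by rewrite mulSn addnC ltn_add2r.
  split=> //; rewrite /J /= divnMDl// divn_small// addn0 modnMDl modn_small//.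
  by rewrite -muE.
have [k kmK Pk] : exists2 k, (k < mK)%N & (P (S t) <= mK%:R%:E * P (D k))%E.
  apply/not_exists2P => h.
  have fP A : measurable A -> P A \is a fin_num by move=> mA; exact: fin_num_measure.
  have lt k : (k < mK)%N -> fine (P (D k)) < fine (P (S t)) / mK%:R.
    move=> kmK; have [//|/negP] := h k.
    rewrite -(fineK (fP _ (mS t))) -(fineK (fP _ (past _ (pD k)))) -EFinM lee_fin.
    by rewrite -ltNge ltr_pdivlMr// mulrC.
  have : (P (S t) <= \sum_(k < mK) P (D k))%E.
    apply: (le_trans _ (Boole_inequality P _)); last by move=> k _; exact: past.
    apply: le_measure => //; rewrite inE//.
    by apply: bigsetU_measurable => k _; exact: past.
  rewrite -(fineK (fP _ (mS t))).
  rewrite (eq_bigr (fun k : 'I_mK => (fine (P (D k)))%:E)) => [|k _]; last first.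
    by rewrite fineK// fP//; exact: past.
  rewrite sumEFin lee_fin leNgt => /negP; apply.
  apply: (@lt_le_trans _ _ (\sum_(k < mK) (fine (P (S t)) / mK%:R))).
    rewrite ltr_sum//; last by move=> k _; exact: lt.
    by apply/hasP; exists (Ordinal mK0n); rewrite ?mem_index_enum.
  by rewrite sumr_const card_ord -[leLHS]mulr_natr divfK// gt_eqF.
pose F := slice U t.+1 (B k).
have mF : measurable F by exact: measurable_slice.
have PF : P F = (p ^+ N)%:E by exact: slice_prob.
have [_ PDF] := past_indep iidU (pD k) (mB k).
rewrite -/F PF in PDF.
have fail : S t.+1 `<=` S t `\` (D k `&` F).
  move=> w Sw; split.
    by move=> s /andP[s1 st]; apply: Sw; rewrite s1 leqW.
  move=> [[_ Jw] Fw].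
  have [_] := Sw t.+1 (introT andP (conj isT (leqnn t.+1))).
  apply/negP; rewrite -ltNge.
  pose i := (k %/ K)%N.
  have [xi rxi] := xl i.
  (* Resampled points, scaled by [rho], stay within [l] of [rho * x i] on either side, since [rho]
     may have any sign; mutation adds at most [l] to the right, hence the length [3 * l]. *)
  apply: (@Dnorm_concentrated N t.+1 _ (rho * x i - l) (3 * l)) => //.
    by rewrite mulr_gt0.
  move=> n; rewrite particlesS//.
  have [mu muE] := weighted_empirical_prob c N0 (run (fun s n => U s n : Omega -> E) w t).
  have [u1 u2] := U01 t.+1 n w isT.
  have [/=] := Fw n; rewrite !in_itv /= => /andP[a1 a2] /andP[b1 b2].
  move: Jw; rewrite /J /= -muE => Jw.
  have := quantile_jumps Jw a1 a2 u1.
  rewrite muE; set xh := quantile _ _ => /andP[xh1 xh2].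
  have := quantile_jumps (mutj xh) b1 b2 u2.
  set y := quantile _ _ => /andP[y1 y2].
  have : `|rho * (xh - x i)| <= l.
    rewrite normrM (le_trans _ rxi)// ler_wpM2l// ger0_norm; last by rewrite subr_ge0 ltW.
    by rewrite lerB.
  rewrite ler_norml mulrBr => /andP[h1 h2].
  move: (rho * xh) (rho * x i) y1 y2 h1 h2; clear => r s y1 y2 h1 h2.
  by apply/andP; split; lra.
have fP A : measurable A -> P A \is a fin_num by move=> mA; exact: fin_num_measure.
have mD : measurable (D k) by exact: past.
have mDF : measurable (D k `&` F) by exact: measurableI.
apply: (@le_trans _ _ (P (S t `\` (D k `&` F)))).
  by apply: le_measure => //; rewrite inE//; exact: measurableD.
have -> : (P (S t `\` (D k `&` F)) = P (S t) - P (D k) * (p ^+ N)%:E)%E.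
  rewrite measureD//; last by rewrite -ge0_fin_numE// fP.
  rewrite (setIidr (_ : D k `&` F `<=` S t)); last by move=> w [[]].
  by congr (_ - _)%E; exact: PDF.
move: Pk; rewrite -(fineK (fP _ (mS t))) -(fineK (fP _ mD)).
rewrite -!EFinM -EFinB !lee_fin.
set a := fine _; set b := fine _ => ab.
have a0 : 0 <= a by rewrite fine_ge0.
have qpN : (p / mK%:R / 2) ^+ N * a <= b * p ^+ N.
  apply: (@le_trans _ _ ((p / mK%:R) ^+ N * (mK%:R * b))).
    apply: ler_pM => //; first by rewrite exprn_ge0// divr_ge0// ltW.
    by rewrite lerXn2r ?nnegrE// ltW// divr_gt0.
  rewrite exprMn -mulrA [leRHS]mulrC ler_wpM2l ?exprn_ge0 ?(ltW p0)//.
  rewrite mulrA ler_piMl//; first by rewrite fine_ge0.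
  rewrite exprVn mulrC ler_pdivrMr ?exprn_gt0// mul1r.
  by rewrite ler_eXnr.
by rewrite mulrBl mul1r; lra.
Qed.

End step.

(** * Lower bound on the number of particles needed for uniform accuracy *)

Unset Implicit Arguments.

Theorem proposition3 (R : realType) (rho sigma c : R)
    (sigma_gt0 : 0 < sigma) (c_gt0 : 0 < c)
    (eta1 : probability (measurableTypeR R) R)
    (qbar : R) (qbar_gt0 : 0 < qbar) (qbar_lt : qbar < 1 / 2)
    (kappa : R) (kappa_gt0 : 0 < kappa) (kappa_lt1 : kappa < 1) :
  exists C : R, 0 < C /\
  exists T0 : nat, (1 <= T0)%N /\
  forall q : R, 0 < q -> q <= qbar ->
  forall T : nat, (T0 <= T)%N ->
  forall N : nat, (1 <= N)%N -> N%:R < C * ln (T%:R / q) ->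
  forall (d : measure_display) (Omega : measurableType d)
    (P : probability Omega R)
    (U : nat -> 'I_N ->
         {RV P >-> (measurableTypeR R * measurableTypeR R)%type}),
  iid_uniform_points U ->
  let X (t : nat) (w : Omega) : 'I_N -> R :=
    particles rho sigma c eta1 (fun s n => U s n w) t in
  (P [set w : Omega |
        ereal_sup [set Dnorm (weighted_empirical c (X t w))
                             (updated rho sigma c eta1 t)
                  | t in [set t : nat | (1 <= t <= T)%N]] <= kappa%:E /\
        ereal_sup [set Dnorm (empirical (X t w))
                             (predicted rho sigma c eta1 t)
                  | t in [set t : nat | (1 <= t <= T)%N]] <= kappa%:E]
     < (1 - q)%:E)%E.
Proof.
have [q0 [q00 q01 step]] := success_step rho sigma_gt0 c_gt0 eta1 kappa_lt1.
have L0 : 0 < ln q0^-1 by rewrite ln_gt0// invf_gt1.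
(* With this constant, [N < C * ln (T / q)] means that [q0 ^+ N] is larger than the square root of
   [q / T]. *)
exists (2 * ln q0^-1)^-1; split; first by rewrite invr_gt0 mulr_gt0.
exists 8; split => //.
move=> q q_gt0 q_le T T8 N N1 NC d Omega P U iidU; cbv zeta.
pose S := success rho sigma c eta1 kappa (fun s n => U s n : Omega -> _).
rewrite [X in P X](_ : _ = S T); last first.
  apply/seteqP; split => w /=.
    move=> [h1 h2] t tT; split.
      by apply: le_trans h1; apply: ereal_sup_ubound; exists t.
    by apply: le_trans h2; apply: ereal_sup_ubound; exists t.
  by move=> h; split; apply: ge_ereal_sup => _ [t tT <-]; case: (h t tT).
have mS t : measurable (S t).
  by apply: measurable_success => // s n w s1; case: iidU => + _ _; exact.
(* The induction starts at time 1 with the trivial bound 1, because a collapse is forced only from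
   time 2 on; hence the exponent [T.-1]. *)
have bound t : (P (S t.+1) <= ((1 - q0 ^+ N) ^+ t)%:E)%E.
  elim: t => [|t IH]; first exact: probability_le1.
  apply: le_trans (step _ _ _ _ _ t.+1 N1 iidU isT) _.
  rewrite exprS EFinM lee_wpmul2l// lee_fin subr_ge0 exprn_ile1// ltW//.
rewrite -(@prednK T); last exact: leq_trans T8.
apply: le_lt_trans (bound _) _; rewrite lte_fin.
by apply: success_bound => //; apply: le_lt_trans q_le qbar_lt.
Qed.
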